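(* Let $\lambda$ be an uncountable cardinal such that $\mathsf{CH}_\lambda$ holds. Then the following are equivalent: (i) $\square_\lambda$; (ii) $\clubsuit\square_\lambda(S)$ holds for every stationary $S\subseteq E^{\lambda^+}_{\neq\operatorname{cf}(\lambda)}$; (iii) $\clubsuit\square_\lambda(S)$ holds for every $S\subseteq\lambda^+$ that reflects stationarily often.
   Context: For a set of ordinals $A$: $\operatorname{acc}^+(A)=\{\alpha<\sup A:\sup(A\cap\alpha)=\alpha\}$, $\operatorname{acc}(A)=\operatorname{acc}^+(A)\cap A$, $\operatorname{nacc}(A)=A\setminus\operatorname{acc}(A)$; $\operatorname{otp}(A)$ is the order type. $E^{\delta}_{\kappa}=\{\alpha<\delta:\operatorname{cf}(\alpha)=\kappa\}$, and $E^\delta_{>\kappa}$, $E^\delta_{\neq\kappa}$, etc. are defined analogously. $\mathsf{CH}_\lambda$ means $2^\lambda=\lambda^+$. A $\square_\lambda$-sequence is a sequence $\langle C_\alpha:\alpha<\lambda^+\rangle$ such that for every limit $\alpha<\lambda^+$, $C_\alpha$ is a club subset of $\alpha$ with $\operatorname{otp}(C_\alpha)\le\lambda$, and if $\beta\in\operatorname{acc}(C_\alpha)$ then $C_\beta=C_\alpha\cap\beta$; $\square_\lambda$ asserts that such a sequence exists. For a stationary $S\subseteq\lambda^+$, $\clubsuit\square_\lambda(S)$ asserts the existence of a $\square_\lambda$-sequence $\langle C_\alpha:\alpha<\lambda^+\rangle$ and a subset $S'\subseteq S$ such that: (3) for every club $D\subseteq\lambda^+$ and every cofinal $A\subseteq\lambda^+$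 there exists $\alpha\in S'$ with $\operatorname{acc}(C_\alpha)\subseteq D$ and $\operatorname{nacc}(C_\alpha)\subseteq A$; (4) $S'\cap\operatorname{acc}(C_\alpha)=\emptyset$ for all $\alpha<\lambda^+$. A set $S\subseteq\lambda^+$ reflects stationarily often if $\{\alpha\in E^{\lambda^+}_{>\omega}: S\cap\alpha \text{ is stationary in }\alpha\}$ is stationary in $\lambda^+$. *)

(* Defs.v *)
(* Ordinals below lambda^+ are modelled by an abstract
   well-ordered type (K, lt) whose order type is lambda^+ (see SuccCardModel). *)
From Stdlib Require Import Classical.

Section Ord.
Context {K : Type} (lt : K -> K -> Prop).

Definition le (x y : K) : Prop := lt x y \/ x = y.

Definition StrictWellOrder : Prop :=
  well_founded lt /\
  (forall x y z, lt x y -> lt y z -> lt x z) /\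
  (forall x y, lt x y \/ x = y \/ lt y x).

Definition below (a : K) : Type := {x : K | lt x a}.

Definition injective_fun {A B : Type} (f : A -> B) : Prop :=
  forall x y, f x = f y -> x = y.

(* lam is an uncountable cardinal and K has order type lam^+ *)
Definition SuccCardModel (lam : K) : Prop :=
  (forall b, lt b lam -> ~ exists f : below lam -> below b, injective_fun f) /\
  (~ exists f : below lam -> nat, injective_fun f) /\
  (forall a, exists f : below a -> below lam, injective_fun f) /\
  (~ exists f : K -> below lam, injective_fun f).

Definition CH (lam : K) : Prop :=
  exists f : (below lam -> Prop) -> K,
    injective_fun f /\ forall y, exists X, f X = y.

Definition IsLimit (a : K) : Prop :=
  (exists b, lt b a) /\ forall b, lt b a -> exists c, lt b c /\ lt c a.

Definition IsOmega (w : K) : Prop :=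
  IsLimit w /\ forall b, lt b w -> ~ IsLimit b.

Definition IsCf (a g : K) : Prop :=
  let cofinal (g' : K) :=
    exists f : below g' -> below a,
      forall x, lt x a -> exists e, le x (proj1_sig (f e)) in
  cofinal g /\ forall g', lt g' g -> ~ cofinal g'.

Definition AccPlus (A : K -> Prop) (b : K) : Prop :=
  (exists c, A c /\ lt b c) /\
  (exists x, lt x b) /\
  (forall x, lt x b -> exists c, A c /\ lt x c /\ lt c b).

Definition Acc (A : K -> Prop) (b : K) : Prop := AccPlus A b /\ A b.
Definition NAcc (A : K -> Prop) (b : K) : Prop := A b /\ ~ Acc A b.

Definition ClubIn (B A : K -> Prop) : Prop :=
  (forall x, A x -> B x) /\
  (forall b, B b -> exists c, A c /\ B c /\ lt b c) /\
  (forall c, B c -> (exists x, lt x c) ->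
     (forall x, lt x c -> exists d, A d /\ lt x d /\ lt d c) -> A c).

Definition ClubBelow (a : K) (A : K -> Prop) : Prop := ClubIn (fun x => lt x a) A.
Definition Club (A : K -> Prop) : Prop := ClubIn (fun _ => True) A.

Definition Cofinal (A : K -> Prop) : Prop := forall b, exists c, A c /\ lt b c.

Definition Stationary (S : K -> Prop) : Prop :=
  forall D, Club D -> exists x, S x /\ D x.

Definition StationaryIn (a : K) (S : K -> Prop) : Prop :=
  forall D, ClubBelow a D -> exists x, lt x a /\ S x /\ D x.

Definition OtpLe (A : K -> Prop) (lam : K) : Prop :=
  exists f : {x : K | A x} -> below lam,
    forall x y, lt (proj1_sig x) (proj1_sig y) ->
                lt (proj1_sig (f x)) (proj1_sig (f y)).

Definition SquareSeq (lam : K) (C : K -> K -> Prop) : Prop :=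
  forall a, IsLimit a ->
    ClubBelow a (C a) /\ OtpLe (C a) lam /\
    forall b, Acc (C a) b -> forall x, C b x <-> (C a x /\ lt x b).

Definition Square (lam : K) : Prop := exists C, SquareSeq lam C.

Definition ClubSquare (lam : K) (S : K -> Prop) : Prop :=
  exists C : K -> K -> Prop, exists S' : K -> Prop,
    SquareSeq lam C /\ (forall x, S' x -> S x) /\
    (forall D A, Club D -> Cofinal A ->
       exists a, S' a /\ (forall x, Acc (C a) x -> D x) /\
                        (forall x, NAcc (C a) x -> A x)) /\
    (forall a x, S' x -> ~ Acc (C a) x).

Definition CfGtOmega (a : K) : Prop :=
  exists g, IsCf a g /\ forall w, IsOmega w -> lt w g.

Definition CfNeq (a lam : K) : Prop :=
  forall g, IsCf a g -> ~ IsCf lam g.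

Definition ReflectsStatOften (S : K -> Prop) : Prop :=
  Stationary (fun a => CfGtOmega a /\ StationaryIn a S).

End Ord.

(* Main.v *)
From Stdlib Require Import Classical ClassicalEpsilon FunctionalExtensionality
  PropExtensionality ProofIrrelevance Cantor Relation_Operators
  Inverse_Image Lexicographic_Product.
Require Import Defs.

(** Fix a square sequence [C], injections [g -> lam] for [g < lam^+], and, by CH, a sequence [c] in
    which every function [lam * lam * lam -> lam^+] occurs cofinally often. The index of [x] in [a] is
    the value at [x] of the injection of the next point of [C a] after [x]; this is coherent along
    [acc (C a)], and if [otp (C a) < lam] then fewer than [lam] points have index at most [j] in [a].

    For an order type [th], a bound [j] and a coherent family [N a] of subsets of [a], points of
    [acc (C a)] and values [c x] for [x] in [N a] can be spliced into a new square sequence whose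
    nonaccumulation points are such values. If the club guessing principle fails for [S], this new
    sequence is refuted by some cofinal set [A_i]. Recursion on [i < lam] lets [N_i] consist of the
    [x] of index at most [j] whose guesses of all earlier [A_k] are correct. If at some [a] in [S] of
    order type [th] correct guesses of all [A_i] have values cofinal in [a], then each [i] yields
    [x_i] in [N_i a] guessing [A_i] wrongly; the [x_i] are distinct, so there are [lam] points of
    index at most [j], a contradiction. If [cf a <> cf lam], a suitable [j] exists at [a] since the
    required index is a monotone function into [lam]; if [S] reflects at [a], it exists
    at a club of points of [acc (C a)]. *)

(** * Extensionality and injections between types *)

Lemma pred_ext {X : Type} (P Q : X -> Prop) :
  (forall x, P x <-> Q x) -> P = Q.
Proof.
  intros H. apply functional_extensionality. intros x.
  apply propositional_extensionality. apply H.
Qed.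

Definition embeds (X Y : Type) : Prop := exists f : X -> Y, injective_fun f.

Lemma embeds_refl X : embeds X X.
Proof. exists (fun x => x). intros x y H. exact H. Qed.

Lemma embeds_trans X Y Z : embeds X Y -> embeds Y Z -> embeds X Z.
Proof.
  intros [f Hf] [g Hg]. exists (fun x => g (f x)).
  intros x y H. apply Hf, Hg, H.
Qed.

Lemma embeds_prod X X' Y Y' : embeds X X' -> embeds Y Y' -> embeds (X * Y) (X' * Y').
Proof.
  intros [f Hf] [g Hg]. exists (fun p => (f (fst p), g (snd p))).
  intros [x y] [x' y'] H. cbn in H. injection H as H1 H2.
  f_equal; auto.
Qed.

Lemma embeds_rel {X Y : Type} (R : X -> Y -> Prop) :
  (forall x, exists y, R x y) ->
  (forall x x' y, R x y -> R x' y -> x = x') -> embeds X Y.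
Proof.
  intros Htot Hinj. destruct (choice R Htot) as [f Hf].
  exists f. intros x x' H. apply (Hinj x x' (f x)); [|rewrite H]; apply Hf.
Qed.

Lemma embeds_nat_prod : embeds (nat * nat) nat.
Proof. exists to_nat. intros p q. apply to_nat_inj. Qed.

Lemma embeds_option_nat : embeds (option nat) nat.
Proof.
  exists (fun o => match o with Some n => S n | None => 0 end).
  intros [n|] [m|] H; congruence.
Qed.

Lemma embeds_option X Y : embeds X Y -> embeds (option X) (option Y).
Proof.
  intros [f Hf]. exists (option_map f).
  intros [x|] [y|] H; cbn in H; try congruence.
  injection H as H. f_equal. auto.
Qed.

Lemma two_points X : ~ embeds X nat -> exists x y : X, x <> y.
Proof.
  intros H. apply NNPP. intros N. apply H. exists (fun _ => 0).
  intros x y _. apply NNPP. intros D. apply N. exists x, y. exact D.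
Qed.

Lemma embeds_option_square X :
  ~ embeds X nat -> embeds (X * X) X -> embeds (option X) X.
Proof.
  intros HX Hsq. destruct (two_points X HX) as (a & b & Hab).
  apply embeds_trans with (2 := Hsq).
  exists (fun o => match o with Some x => (x, a) | None => (a, b) end).
  intros [x|] [y|] H; congruence.
Qed.

(** * Well-founded recursion *)

Section WellFoundedRecursion.
Context {X Y : Type} (R : X -> X -> Prop) (wfR : well_founded R) (y0 : Y).

(** The step receives a total function, padded with [y0] outside the predecessors; a step that reads
    only predecessors never sees the padding. *)
Definition wfrec (F : X -> (X -> Y) -> Y) : X -> Y :=
  Fix wfR (fun _ => Y) (fun x rec =>
    F x (fun y => match excluded_middle_informative (R y x) with
                  | left h => rec y h
                  | right _ => y0
                  end)).

Lemma wfrec_eq (F : X -> (X -> Y) -> Y) :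
  (forall x f g, (forall y, R y x -> f y = g y) -> F x f = F x g) ->
  forall x, wfrec F x = F x (wfrec F).
Proof.
  intros HF x. unfold wfrec at 1. rewrite Fix_eq.
  - apply HF. intros y Hy.
    destruct (excluded_middle_informative (R y x)); [reflexivity | contradiction].
  - intros z f g H. f_equal. apply functional_extensionality. intros y.
    destruct (excluded_middle_informative (R y z)); auto.
Qed.

End WellFoundedRecursion.

Lemma slexprod_trans A B (RA : A -> A -> Prop) (RB : B -> B -> Prop) :
  (forall x y z, RA x y -> RA y z -> RA x z) ->
  (forall x y z, RB x y -> RB y z -> RB x z) ->
  forall x y z, slexprod A B RA RB x y -> slexprod A B RA RB y z ->
    slexprod A B RA RB x z.
Proof.
  intros HA HB x y z H1 H2.
  inversion H1; subst; inversion H2; subst; constructor; solve [eauto].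
Qed.

Lemma slexprod_total A B (RA : A -> A -> Prop) (RB : B -> B -> Prop) :
  (forall x y, RA x y \/ x = y \/ RA y x) ->
  (forall x y, RB x y \/ x = y \/ RB y x) ->
  forall x y, slexprod A B RA RB x y \/ x = y \/ slexprod A B RA RB y x.
Proof.
  intros HA HB [a b] [a' b'].
  destruct (HA a a') as [H|[->|H]]; [left; now constructor| |right; right; now constructor].
  destruct (HB b b') as [H|[->|H]];
    [left; now constructor|auto|right; right; now constructor].
Qed.

(** * Well-ordered types *)

Section Development.
Context {K : Type} (lt : K -> K -> Prop).
Local Infix "≺" := lt (at level 70).
Local Infix "≼" := (le lt) (at level 70).

Hypothesis WO : StrictWellOrder lt.

Lemma ltK_wf : well_founded lt.
Proof. apply WO. Qed.

Lemma ltK_trans x y z : x ≺ y -> y ≺ z -> x ≺ z.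
Proof. apply WO. Qed.

Lemma ltK_total x y : x ≺ y \/ x = y \/ y ≺ x.
Proof. apply WO. Qed.

Lemma ltK_irrefl x : ~ x ≺ x.
Proof.
  induction x as [x IH] using (well_founded_ind ltK_wf).
  intros H. exact (IH x H H).
Qed.

Lemma leK_refl x : x ≼ x.
Proof. right. reflexivity. Qed.

Lemma ltK_leK x y : x ≺ y -> x ≼ y.
Proof. left. assumption. Qed.

Lemma eq_leK x y : x = y -> x ≼ y.
Proof. right. assumption. Qed.

Lemma leK_ltK_trans x y z : x ≼ y -> y ≺ z -> x ≺ z.
Proof. intros [H| ->] H'; [exact (ltK_trans _ _ _ H H')|exact H']. Qed.

Lemma ltK_leK_trans x y z : x ≺ y -> y ≼ z -> x ≺ z.
Proof. intros H [H'|<-]; [exact (ltK_trans _ _ _ H H')|exact H]. Qed.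

Lemma leK_trans x y z : x ≼ y -> y ≼ z -> x ≼ z.
Proof. intros H [H'|<-]; [left; exact (leK_ltK_trans _ _ _ H H')|exact H]. Qed.

Lemma nltK x y : ~ x ≺ y -> y ≼ x.
Proof. intros H. destruct (ltK_total x y) as [h|[h|h]]; [easy|right; auto|left; auto]. Qed.

Lemma nleK x y : ~ x ≼ y -> y ≺ x.
Proof.
  intros H. destruct (ltK_total x y) as [h|[h|h]]; auto; exfalso; apply H; [left|right]; auto.
Qed.

Ltac new_fact H :=
  let T := type of H in
  lazymatch goal with
  | _ : T |- _ => fail
  | _ => pose proof H
  end.

Ltac saturate :=
  repeat match goal with
  | H : ?x = ?y |- _ =>
      lazymatch type of x with K => idtac end;
      pose proof (eq_leK x y H); pose proof (eq_leK y x (eq_sym H)); clear H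
  | H : ~ (?x ≺ ?y) |- _ => apply nltK in H
  | H : ~ (?x ≼ ?y) |- _ => apply nleK in H
  | H : ?x ≺ ?x |- _ => exact (False_ind _ (ltK_irrefl x H))
  | H1 : ?x ≺ ?y, H2 : ?y ≺ ?z |- _ => new_fact (ltK_trans x y z H1 H2)
  | H1 : ?x ≼ ?y, H2 : ?y ≺ ?z |- _ => new_fact (leK_ltK_trans x y z H1 H2)
  | H1 : ?x ≺ ?y, H2 : ?y ≼ ?z |- _ => new_fact (ltK_leK_trans x y z H1 H2)
  | H1 : ?x ≼ ?y, H2 : ?y ≼ ?z |- _ => new_fact (leK_trans x y z H1 H2)
  end.

(** Refutes the negated goal: inequalities are closed under transitivity until some [x ≺ x] appears,
    equations counting as two weak inequalities. *)
Ltac order :=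
  intros;
  lazymatch goal with
  | |- @eq K ?x ?y =>
      let H := fresh in
      destruct (ltK_total x y) as [H|[H|H]]; [exfalso|exact H|exfalso]; saturate
  | |- False => saturate
  | |- ~ _ => intro; saturate
  | |- _ => apply NNPP; intro; saturate
  end.

Lemma least_exists (P : K -> Prop) :
  (exists x, P x) -> exists x, P x /\ forall y, P y -> x ≼ y.
Proof.
  intros [x Hx]. revert Hx.
  induction x as [x IH] using (well_founded_ind ltK_wf). intros Hx.
  destruct (classic (exists y, P y /\ y ≺ x)) as [(y & Hy & Hyx)|N].
  - exact (IH y Hyx Hy).
  - exists x. split; [exact Hx|]. intros y Hy. apply nltK. intros h. apply N. eauto.
Qed.

(* [least P] is unspecified when [P] is empty; [lam] only witnesses that [K] is inhabited. *)
Context (lam : K).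

Definition least (P : K -> Prop) : K :=
  epsilon (inhabits lam) (fun x => P x /\ forall y, P y -> x ≼ y).

Lemma least_spec (P : K -> Prop) :
  (exists x, P x) -> P (least P) /\ forall y, P y -> least P ≼ y.
Proof.
  intros H. unfold least. apply epsilon_spec. apply least_exists, H.
Qed.

Lemma least_unique (P : K -> Prop) x :
  P x -> (forall y, P y -> x ≼ y) -> least P = x.
Proof.
  intros H1 H2. destruct (least_spec P) as [H3 H4]; [eauto|].
  specialize (H2 _ H3). specialize (H4 _ H1). order.
Qed.

Lemma below_ext a (x y : below lt a) : proj1_sig x = proj1_sig y -> x = y.
Proof.
  destruct x as [x Hx], y as [y Hy]; cbn; intros ->. f_equal. apply proof_irrelevance.
Qed.

Lemma embeds_below_rel {X} (a : K) (R : X -> K -> Prop) :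
  (forall x, exists y, y ≺ a /\ R x y) ->
  (forall x x' y, R x y -> R x' y -> x = x') -> embeds X (below lt a).
Proof.
  intros H1 H2. apply (embeds_rel (fun x (y : below lt a) => R x (proj1_sig y))).
  - intros x. destruct (H1 x) as (y & Hy & HR). now exists (exist _ y Hy).
  - intros x x' y. apply H2.
Qed.

Lemma embeds_below_le a b : a ≼ b -> embeds (below lt a) (below lt b).
Proof.
  intros Hab. apply (embeds_below_rel b (fun x y => proj1_sig x = y)).
  - intros [x Hx]. exists x. cbn. split; [order|auto].
  - intros x x' y <- H. apply below_ext. auto.
Qed.

(** * Ranks of well-founded relations *)

Section Rank.
Context {X : Type} (R : X -> X -> Prop) (wfR : well_founded R).

Definition rank : X -> K :=
  wfrec R wfR lam (fun x f => least (fun z => forall y, R y x -> f y ≺ z)).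

Lemma rank_eq x : rank x = least (fun z => forall y, R y x -> rank y ≺ z).
Proof.
  apply (wfrec_eq R wfR lam (fun x f => least (fun z => forall y, R y x -> f y ≺ z))).
  clear x. intros x f g H. f_equal. apply pred_ext. intros z.
  split; intros Hz y Hy; [rewrite <- H|rewrite H]; auto.
Qed.

(** The bound [b] guarantees that the [least] in the recursion is taken over a nonempty class;
    without a bound the rank would be an unspecified value. *)
Lemma rank_lt x b :
  (forall y, R y x -> rank y ≺ b) -> rank x ≼ b /\ forall y, R y x -> rank y ≺ rank x.
Proof.
  intros H. rewrite rank_eq.
  destruct (least_spec (fun z => forall y, R y x -> rank y ≺ z)) as [H1 H2]; eauto.
Qed.

Hypothesis R_trans : forall x y z, R x y -> R y z -> R x z.

(** Some predecessor [y] has [z ≼ rank y], since otherwise [z] bounds all ranks of predecessors and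
    [rank x ≼ z]; induction then descends to [y]. *)
Lemma rank_onto z x :
  (forall y, (y = x \/ R y x) -> exists b, forall y', R y' y -> rank y' ≺ b) ->
  z ≺ rank x -> exists y, R y x /\ rank y = z.
Proof.
  induction x as [x IH] using (well_founded_ind wfR). intros Hb Hz.
  assert (Hy : exists y, R y x /\ z ≼ rank y).
  { apply NNPP. intros N.
    assert (rank x ≼ z); [|order].
    apply rank_lt. intros y Hy. apply NNPP. intros h. apply N.
    exists y. split; [exact Hy|order]. }
  destruct Hy as (y & Hy & Hzy).
  destruct Hzy as [Hzy|Hzy]; [|exists y; auto].
  destruct (IH y Hy) as (y' & Hy' & Hr); [|exact Hzy|].
  - intros y' [->|h]; apply Hb; eauto.
  - exists y'. eauto.
Qed.

End Rank.

(** * Cardinal arithmetic *)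

(** The countable alternative absorbs the finite ordinals, whose squares need not embed back. *)
Definition sq_small (x : K) : Prop :=
  embeds (below lt x) nat \/ embeds (below lt x * below lt x) (below lt x).

Lemma embeds_initial m :
  sq_small m ->
  embeds {z : K | z ≼ m} nat \/ embeds {z : K | z ≼ m} (below lt m).
Proof.
  intros Hm.
  assert (E : embeds {z : K | z ≼ m} (option (below lt m))).
  { apply (embeds_rel (fun z o => match o with
                                  | Some y => proj1_sig y = proj1_sig z
                                  | None => proj1_sig z = m end)).
    - intros [z [Hz|Hz]]; [exists (Some (exist _ z Hz))|exists None]; cbn; auto.
    - intros [z Hz] [z' Hz'] o H1 H2. cbn in *.
      assert (z = z') as -> by (destruct o; congruence).
      f_equal. apply proof_irrelevance. }
  destruct (classic (embeds (below lt m) nat)) as [H|H].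
  - left. apply (embeds_trans _ _ _ E).
    apply embeds_trans with (2 := embeds_option_nat). apply embeds_option, H.
  - right. destruct Hm as [Hm|Hm]; [contradiction|].
    apply (embeds_trans _ _ _ E). apply embeds_option_square; assumption.
Qed.

Lemma embeds_prod_small X Y m :
  sq_small m -> embeds X (below lt m) -> embeds Y (below lt m) ->
  embeds (X * Y) nat \/ embeds (X * Y) (below lt m).
Proof.
  intros [H|H] HX HY; [left|right].
  - apply embeds_trans with (2 := embeds_nat_prod).
    apply embeds_prod; eapply embeds_trans; eassumption.
  - apply embeds_trans with (2 := H). apply embeds_prod; assumption.
Qed.

(* The canonical order on pairs compares maxima first, so that an initial segment below a pair
   with maximum [m] lies in [(m+1) * (m+1)]. *)
Section Hessenberg.
Context (x : K).

Definition maxK (a b : K) : K := if excluded_middle_informative (a ≺ b) then b else a.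

Lemma maxK_spec a b c : maxK a b ≼ c <-> a ≼ c /\ b ≼ c.
Proof.
  unfold maxK. destruct (excluded_middle_informative (a ≺ b));
    (split; [intros; split|intros []]; order).
Qed.

Definition godel_key (p : below lt x * below lt x) : (K * K) * K :=
  let a := proj1_sig (fst p) in let b := proj1_sig (snd p) in ((maxK a b, a), b).

Definition godel (p q : below lt x * below lt x) : Prop :=
  slexprod (K * K) K (slexprod K K lt lt) lt (godel_key p) (godel_key q).

Lemma godel_wf : well_founded godel.
Proof.
  refine (wf_inverse_image _ _ _ godel_key _).
  apply wf_slexprod; [apply wf_slexprod|]; apply ltK_wf.
Qed.

Lemma godel_trans p q r : godel p q -> godel q r -> godel p r.
Proof.
  apply slexprod_trans; [apply slexprod_trans|]; apply ltK_trans.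
Qed.

Lemma godel_total p q : godel p q \/ p = q \/ godel q p.
Proof.
  unfold godel.
  destruct (slexprod_total _ _ (slexprod K K lt lt) lt
    (slexprod_total _ _ lt lt ltK_total ltK_total) ltK_total (godel_key p) (godel_key q))
    as [H|[H|H]]; auto.
  right. left. destruct p as [a b], q as [c d]. unfold godel_key in H. cbn in H.
  injection H as _ H1 H2. f_equal; apply below_ext; assumption.
Qed.

Lemma godel_max p q : godel p q ->
  maxK (proj1_sig (fst p)) (proj1_sig (snd p)) ≼ maxK (proj1_sig (fst q)) (proj1_sig (snd q)).
Proof.
  unfold godel, godel_key. intros H. inversion H; subst; [|apply leK_refl].
  match goal with h : slexprod _ _ _ _ _ _ |- _ => inversion h; subst end;
    [apply ltK_leK; assumption|apply leK_refl].
Qed.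

End Hessenberg.

(** If [x] embeds below a smaller ordinal, the square embedding is transferred from there. If [x] is
    an uncountable initial ordinal, the rank of the canonical order is the required injection. Were
    a pair [p] with maximum [m] the first of rank [x], every ordinal below [x] would be the rank of
    a pair before [p], and [x] would embed into the square of [m+1], hence into [nat] or below
    [m]. *)
Lemma hessenberg x : sq_small x.
Proof.
  induction x as [x IH] using (well_founded_ind ltK_wf).
  destruct (classic (embeds (below lt x) nat)) as [Hc|Hc]; [left; exact Hc|].
  destruct (classic (exists y, y ≺ x /\ embeds (below lt x) (below lt y)))
    as [(y & Hy & E)|Hinit].
  { destruct (IH y Hy) as [H|H].
    - left. eapply embeds_trans; eassumption.
    - right. apply embeds_trans with (2 := embeds_below_le y x (ltK_leK _ _ Hy)).
      apply embeds_trans with (2 := H). apply embeds_prod; assumption. }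
  right.
  set (r := rank (godel x) (godel_wf x)).
  assert (Hr : forall p, r p ≺ x).
  { intros p. induction p as [p IHp] using (well_founded_ind (godel_wf x)).
    destruct (rank_lt (godel x) (godel_wf x) p x IHp) as [Hle _]. fold r in Hle.
    destruct Hle as [Hlt|Heq]; [exact Hlt|exfalso].
    set (m := maxK (proj1_sig (fst p)) (proj1_sig (snd p))).
    assert (Hm : m ≺ x).
    { destruct p as [[a Ha] [b Hb]]. unfold m, maxK. cbn.
      destruct (excluded_middle_informative (a ≺ b)); assumption. }
    assert (E : embeds (below lt x) ({z | z ≼ m} * {z | z ≼ m})).
    { apply (embeds_rel (fun z ab => exists q, r q = proj1_sig z /\
         proj1_sig (fst ab) = proj1_sig (fst q) /\ proj1_sig (snd ab) = proj1_sig (snd q))).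
      - intros [z Hz].
        destruct (rank_onto (godel x) (godel_wf x) (godel_trans x) z p) as (q & Hq & Hrq).
        + intros q Hq. exists x. intros q' Hq'. apply IHp.
          destruct Hq as [->|Hq]; [exact Hq'|]. eapply godel_trans; eassumption.
        + fold r. rewrite Heq. exact Hz.
        + pose proof (godel_max x q p Hq) as H. fold m in H.
          apply maxK_spec in H. destruct H as [H1 H2].
          exists (exist (fun z => z ≼ m) _ H1, exist (fun z => z ≼ m) _ H2), q. cbn. auto.
      - intros z z' [a b] (q & E1 & E2 & E3) (q' & F1 & F2 & F3). cbn in *.
        apply below_ext. rewrite <- E1, <- F1. f_equal.
        destruct q, q'; cbn in *. f_equal; apply below_ext; congruence. }
    destruct (embeds_initial m (IH m Hm)) as [H|H].
    - apply Hc. apply (embeds_trans _ _ _ E).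
      apply embeds_trans with (2 := embeds_nat_prod). apply embeds_prod; assumption.
    - destruct (embeds_prod_small _ _ m (IH m Hm) H H) as [H'|H'].
      + apply Hc. eapply embeds_trans; eassumption.
      + apply Hinit. exists m. split; [exact Hm|]. eapply embeds_trans; eassumption. }
  assert (Hmono : forall p q, godel x p q -> r p ≺ r q).
  { intros p q Hpq. apply (rank_lt (godel x) (godel_wf x) q x); auto. }
  exists (fun p => exist _ (r p) (Hr p)).
  intros p q H. injection H as H.
  destruct (godel_total x p q) as [h|[h|h]]; [|exact h|]; apply Hmono in h; order.
Qed.

(** * Arithmetic of [lam] and regularity of its successor *)

Hypothesis SC : SuccCardModel lt lam.

Local Notation L := (below lt lam).
Local Notation inL h := (exist (fun z => z ≺ lam) _ h).

Lemma lam_initial b : b ≺ lam -> ~ embeds L (below lt b).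
Proof. apply SC. Qed.

Lemma lam_uncountable : ~ embeds L nat.
Proof. apply SC. Qed.

Lemma below_embeds_lam a : embeds (below lt a) L.
Proof. apply SC. Qed.

Lemma K_large : ~ embeds K L.
Proof. apply SC. Qed.

Lemma lam_square : embeds (L * L) L.
Proof.
  destruct (hessenberg lam) as [H|H]; [|exact H].
  exfalso. exact (lam_uncountable H).
Qed.

Lemma lam_not_embeds_prod X Y a b : a ≺ lam -> b ≺ lam ->
  embeds X (below lt a) -> embeds Y (below lt b) -> ~ embeds L (X * Y).
Proof.
  intros Ha Hb HX HY E.
  set (m := maxK a b).
  assert (Hm : m ≺ lam).
  { unfold m, maxK. destruct (excluded_middle_informative (a ≺ b)); assumption. }
  assert (Hab : a ≼ m /\ b ≼ m) by (apply maxK_spec, leK_refl).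
  destruct Hab as [Ham Hbm].
  destruct (embeds_prod_small X Y m (hessenberg m)) as [H|H].
  - eapply embeds_trans; [exact HX|]. apply embeds_below_le, Ham.
  - eapply embeds_trans; [exact HY|]. apply embeds_below_le, Hbm.
  - apply lam_uncountable. eapply embeds_trans; eassumption.
  - apply (lam_initial m Hm). eapply embeds_trans; eassumption.
Qed.

(** If [a] were the last point below [lam], then [lam] would embed into [a+1], which is countable or
    embeds below [a]. *)
Lemma lam_limit a : a ≺ lam -> exists b, a ≺ b /\ b ≺ lam.
Proof.
  intros Ha. apply NNPP. intros N.
  assert (E : embeds L {z | z ≼ a}).
  { apply (embeds_rel (fun x z => proj1_sig x = proj1_sig z)).
    - intros [x Hx].
      assert (Hxa : x ≼ a) by (apply nltK; intros h; apply N; eauto).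
      exists (exist (fun z => z ≼ a) x Hxa). reflexivity.
    - intros x x' z H1 H2. apply below_ext. congruence. }
  destruct (embeds_initial a (hessenberg a)) as [H|H].
  - apply lam_uncountable. eapply embeds_trans; eassumption.
  - apply (lam_initial a Ha). eapply embeds_trans; eassumption.
Qed.

Lemma K_limit a : exists b, a ≺ b.
Proof.
  apply NNPP. intros N.
  assert (E : embeds K {z | z ≼ a}).
  { apply (embeds_rel (fun x z => x = proj1_sig z)); [|congruence].
    intros x. assert (Hxa : x ≼ a) by (apply nltK; intros h; apply N; eauto).
    exists (exist (fun z => z ≼ a) x Hxa). reflexivity. }
  apply K_large. apply (embeds_trans _ _ _ E).
  destruct (embeds_initial a (hessenberg a)) as [H|H].
  - destruct lam_square as [p Hp].
    exfalso. apply lam_uncountable.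
    assert (embeds L K) by (exists (@proj1_sig _ _); intros x y; apply below_ext).
    eapply embeds_trans; [eassumption|]. eapply embeds_trans; eassumption.
  - eapply embeds_trans; [exact H|]. apply below_embeds_lam.
Qed.

Lemma index_exists : exists ind : K -> K -> K, forall g x, x ≺ g ->
  ind g x ≺ lam /\ forall y, y ≺ g -> ind g x = ind g y -> x = y.
Proof.
  apply (choice (fun g (h : K -> K) => forall x, x ≺ g ->
    h x ≺ lam /\ forall y, y ≺ g -> h x = h y -> x = y)).
  intros g. destruct (below_embeds_lam g) as [f Hf].
  exists (fun x => match excluded_middle_informative (x ≺ g) with
                   | left h => proj1_sig (f (exist _ x h))
                   | right _ => x
                   end).
  intros x Hx. destruct (excluded_middle_informative (x ≺ g)) as [h|]; [|easy].
  split; [apply proj2_sig|]. intros y Hy.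
  destruct (excluded_middle_informative (y ≺ g)) as [h'|]; [|easy].
  intros E. apply below_ext, Hf in E. congruence.
Qed.

(** If the values were unbounded, each [b] could be coded by some [i] with [b ≺ f i] together with
    the index of [b] in [f i], embedding [K] into the square of [lam]. *)
Lemma bounded (I : Type) (f : I -> K) : embeds I L -> exists b, forall i, f i ≺ b.
Proof.
  intros HI. destruct (classic (exists b, forall i, f i ≼ b)) as [[b Hb]|N].
  - destruct (K_limit b) as [c Hc]. exists c. intros i. specialize (Hb i). order.
  - exfalso. apply K_large. apply embeds_trans with (2 := lam_square).
    apply embeds_trans with (Y := (I * L)%type);
      [|apply embeds_prod; [exact HI|apply embeds_refl]].
    destruct index_exists as [ind Hind].
    apply (embeds_rel (fun b il => b ≺ f (fst il) /\ ind (f (fst il)) b = proj1_sig (snd il))).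
    + intros b. assert (Hi : exists i, b ≺ f i).
      { apply NNPP. intros h. apply N. exists b. intros i.
        apply nltK. intros h'. apply h. eauto. }
      destruct Hi as [i Hi]. destruct (Hind _ _ Hi) as [Hl _].
      exists (i, inL Hl). cbn. auto.
    + intros b b' [i l] [H1 E1] [H2 E2]. cbn in *.
      apply (Hind _ _ H1); congruence.
Qed.

(** * The ordinals [omega] and [omega1] *)

Fixpoint omega_seq (n : nat) : K :=
  match n with
  | 0 => least (fun _ => True)
  | S n => least (fun z => omega_seq n ≺ z)
  end.

Lemma omega_seq_succ n :
  omega_seq n ≺ omega_seq (S n) /\ forall z, omega_seq n ≺ z -> omega_seq (S n) ≼ z.
Proof. apply (least_spec (fun z => omega_seq n ≺ z)), K_limit. Qed.

Lemma omega_seq_0 z : omega_seq 0 ≼ z.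
Proof. apply least_spec; eauto. Qed.

Lemma increasing_seq (x : nat -> K) :
  (forall n, x n ≺ x (S n)) -> forall n m, n < m -> x n ≺ x m.
Proof.
  intros H n m Hnm. induction Hnm as [|m Hnm IH]; [apply H|].
  specialize (H m). order.
Qed.

Lemma increasing_seq_inj (x : nat -> K) :
  (forall n, x n ≺ x (S n)) -> forall n m, x n = x m -> n = m.
Proof.
  intros H n m E. destruct (Compare_dec.lt_eq_lt_dec n m) as [[h|h]|h]; [|exact h|];
    apply (increasing_seq x H) in h; order.
Qed.

Lemma omega_seq_initial n y : y ≺ omega_seq n -> exists k, y = omega_seq k.
Proof.
  induction n as [|n IH]; intros Hy.
  - pose proof (omega_seq_0 y). order.
  - destruct (omega_seq_succ n) as [_ H].
    destruct (ltK_total y (omega_seq n)) as [h|[h|h]]; eauto.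
    apply H in h. order.
Qed.

Lemma omega_seq_lam n : omega_seq n ≺ lam.
Proof.
  apply NNPP. intros h. apply nltK in h. apply lam_uncountable.
  apply (embeds_rel (fun y k => proj1_sig y = omega_seq k)).
  - intros [y Hy]. apply (omega_seq_initial n). cbn. order.
  - intros x y k H1 H2. apply below_ext. congruence.
Qed.

Lemma nat_embeds_lam : embeds nat L.
Proof.
  exists (fun n => inL (omega_seq_lam n)).
  intros n m H. injection H as H. revert H.
  apply (increasing_seq_inj omega_seq). intros k. apply omega_seq_succ.
Qed.

Definition omega : K := least (fun z => forall n, omega_seq n ≺ z).

Lemma omega_spec : (forall n, omega_seq n ≺ omega) /\
  forall z, z ≺ omega -> exists n, z = omega_seq n.
Proof.
  destruct (least_spec (fun z => forall n, omega_seq n ≺ z)) as [H1 H2].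
  { exists lam. apply omega_seq_lam. }
  fold omega in H1, H2. split; [exact H1|].
  intros z Hz. apply NNPP. intros N. assert (omega ≼ z); [|order].
  apply H2. intros n. apply NNPP. intros h. apply nltK in h.
  destruct h as [h|h]; [apply omega_seq_initial in h; auto|eauto].
Qed.

Lemma omega_limit : IsLimit lt omega.
Proof.
  destruct omega_spec as [H1 H2]. split; [exists (omega_seq 0); apply H1|].
  intros b Hb. destruct (H2 b Hb) as [n ->]. exists (omega_seq (S n)).
  split; [apply omega_seq_succ|apply H1].
Qed.

Lemma omega_countable : embeds (below lt omega) nat.
Proof.
  apply (embeds_rel (fun y k => proj1_sig y = omega_seq k)).
  - intros [y Hy]. apply omega_spec, Hy.
  - intros x y k E1 E2. apply below_ext. congruence.
Qed.

Lemma omega_IsOmega : IsOmega lt omega.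
Proof.
  destruct omega_spec as [H1 H2]. split; [apply omega_limit|].
  intros b Hb [[y Hy] HL]. destruct (H2 b Hb) as [[|n] ->].
  - pose proof (omega_seq_0 y). order.
  - destruct (HL (omega_seq n)) as (c & Hc & Hc'); [apply omega_seq_succ|].
    apply omega_seq_succ in Hc. order.
Qed.

Definition omega1 : K := least (fun g => ~ embeds (below lt g) nat).

Lemma omega1_spec : ~ embeds (below lt omega1) nat /\
  forall z, z ≺ omega1 -> embeds (below lt z) nat.
Proof.
  destruct (least_spec (fun g => ~ embeds (below lt g) nat)) as [H1 H2].
  { exists lam. exact lam_uncountable. }
  fold omega1 in H1, H2. split; [exact H1|]. intros z Hz. apply NNPP. intros h.
  apply H2 in h. order.
Qed.

Lemma omega_lt_omega1 : omega ≺ omega1.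
Proof.
  apply NNPP. intros h. apply nltK in h. apply omega1_spec.
  apply embeds_trans with (2 := omega_countable). apply embeds_below_le, h.
Qed.

Lemma IsOmega_le_omega w : IsOmega lt w -> w ≼ omega.
Proof.
  intros [_ H]. apply nltK. intros h. exact (H _ h omega_limit).
Qed.

(* Countable unions of countable sets are countable. *)
Lemma omega1_regular (I : Type) (f : I -> K) : embeds I nat -> (forall i, f i ≺ omega1) ->
  exists b, b ≺ omega1 /\ forall i, f i ≺ b.
Proof.
  intros HI Hf. apply NNPP. intros N. apply omega1_spec.
  assert (Hc : forall i, embeds {z | z ≼ f i} nat).
  { intros i. destruct (embeds_initial (f i) (hessenberg (f i))) as [H|H]; [exact H|].
    eapply embeds_trans; [exact H|]. apply omega1_spec, Hf. }
  set (g i := constructive_indefinite_description _ (Hc i)).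
  apply embeds_trans with (2 := embeds_nat_prod).
  apply embeds_trans with (Y := (I * nat)%type);
    [|apply embeds_prod; [exact HI|apply embeds_refl]].
  apply (embeds_rel (fun (b : below lt omega1) (p : I * nat) => exists h : proj1_sig b ≼ f (fst p),
    proj1_sig (g (fst p)) (exist (fun z => z ≼ f (fst p)) _ h) = snd p)).
  - intros [b Hb]. assert (Hi : exists i, b ≼ f i).
    { apply NNPP. intros h. apply N. exists b. split; [exact Hb|]. intros i.
      apply nleK. intros h'. apply h. eauto. }
    destruct Hi as [i Hi].
    exists (i, proj1_sig (g i) (exist (fun z => z ≼ f i) b Hi)), Hi. reflexivity.
  - intros b b' [i n] [h E] [h' E']. cbn in *. rewrite <- E' in E.
    apply (proj2_sig (g i)) in E. apply below_ext. congruence.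
Qed.

(** * Cofinality *)

Lemma omega_chain (P : K -> Prop) (R : K -> K -> Prop) :
  (forall x, P x -> exists y, P y /\ x ≺ y /\ R x y) -> forall b, P b ->
  exists x : nat -> K, x 0 = b /\ forall n, P (x n) /\ x n ≺ x (S n) /\ R (x n) (x (S n)).
Proof.
  intros H b Hb.
  destruct (choice (fun x y => P x -> P y /\ x ≺ y /\ R x y)) as [F HF].
  { intros x. destruct (classic (P x)) as [Hx|Hx]; [|exists x; easy].
    destruct (H x Hx) as [y Hy]. eauto. }
  set (x := fix x n := match n with 0 => b | S n => F (x n) end).
  assert (HP : forall n, P (x n)).
  { intros n. induction n as [|n IH]; [exact Hb|]. apply (HF _ IH). }
  exists x. split; [reflexivity|]. intros n. split; [apply HP|]. apply (HF _ (HP n)).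
Qed.

Lemma limit_sup (I : Type) (i0 : I) (f : I -> K) z :
  (forall i, exists j, f i ≺ f j) -> (forall i, f i ≺ z) ->
  exists a, a ≼ z /\ IsLimit lt a /\ (forall i, f i ≺ a) /\
    forall b, b ≺ a -> exists i, b ≺ f i.
Proof.
  intros Hinc Hz.
  destruct (least_spec (fun z => forall i, f i ≺ z)) as [H1 H2]; [eauto|].
  set (a := least _) in *.
  assert (Hsup : forall b, b ≺ a -> exists i, b ≺ f i).
  { intros b Hb. apply NNPP. intros N. assert (a ≼ b); [|order]. apply H2.
    intros i. apply NNPP. intros h. destruct (Hinc i) as [j Hj].
    apply N. exists j. order. }
  exists a. split; [auto|]. split; [|auto]. split; [exists (f i0); apply H1|].
  intros b Hb. destruct (Hsup b Hb) as [i Hi]. eauto.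
Qed.

(** This is the predicate bound locally in [IsCf], named so that it can be folded. *)
Definition cofinal_map (a g : K) : Prop :=
  exists f : below lt g -> below lt a,
    forall x, x ≺ a -> exists e, x ≼ proj1_sig (f e).

Lemma cofinal_map_intro a g (f : K -> K) :
  (forall e, e ≺ g -> f e ≺ a) ->
  (forall x, x ≺ a -> exists e, e ≺ g /\ x ≼ f e) -> cofinal_map a g.
Proof.
  intros H1 H2.
  exists (fun e => exist (fun z => z ≺ a) (f (proj1_sig e)) (H1 _ (proj2_sig e))).
  intros x Hx. destruct (H2 x Hx) as (e & He & Hxe).
  exists (exist _ e He). exact Hxe.
Qed.

Lemma cofinal_map_elim a g : cofinal_map a g -> exists f : K -> K,
  (forall e, e ≺ g -> f e ≺ a) /\ (forall x, x ≺ a -> exists e, e ≺ g /\ x ≼ f e).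
Proof.
  intros [f Hf].
  exists (fun e => match excluded_middle_informative (e ≺ g) with
                   | left h => proj1_sig (f (exist _ e h))
                   | right _ => e
                   end).
  split.
  - intros e He. destruct (excluded_middle_informative (e ≺ g)) as [h|]; [|easy].
    apply proj2_sig.
  - intros x Hx. destruct (Hf x Hx) as [[e He] Hxe]. exists e. split; [exact He|].
    destruct (excluded_middle_informative (e ≺ g)) as [h|]; [|easy].
    replace h with He by apply proof_irrelevance. exact Hxe.
Qed.

Lemma cofinal_map_refl a : cofinal_map a a.
Proof.
  apply (cofinal_map_intro a a (fun x => x)); [easy|].
  intros x Hx. exists x. split; [easy|apply leK_refl].
Qed.

Lemma cf_exists a : exists g, IsCf lt a g.
Proof.
  destruct (least_exists (cofinal_map a)) as (g & H1 & H2).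
  { exists a. apply cofinal_map_refl. }
  exists g. split; [exact H1|]. intros g' Hg' H. apply H2 in H. order.
Qed.

Lemma cf_le a g g' : IsCf lt a g -> cofinal_map a g' -> g ≼ g'.
Proof. intros [_ H] H'. apply nltK. intros h. exact (H _ h H'). Qed.

Lemma cf_unique a g g' : IsCf lt a g -> IsCf lt a g' -> g = g'.
Proof.
  intros H H'. pose proof (cf_le a g g' H (proj1 H')).
  pose proof (cf_le a g' g H' (proj1 H)). order.
Qed.

(** Composing with [F] turns cofinal maps into [a] into cofinal maps into [b]. Conversely, pull
    [f e] back to some [h e] with [f e ≼ F (h e)]. As [b] has no last point, some [f e] lies
    strictly above [F x], and monotonicity forces [x ≼ h e]. *)
Lemma cf_transfer a b (F : K -> K) :
  (forall z, z ≺ b -> exists z', z ≺ z' /\ z' ≺ b) ->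
  (forall x, x ≺ a -> F x ≺ b) ->
  (forall x y, x ≼ y -> y ≺ a -> F x ≼ F y) ->
  (forall z, z ≺ b -> exists x, x ≺ a /\ z ≼ F x) ->
  forall g, IsCf lt a g <-> IsCf lt b g.
Proof.
  intros Hb H1 H2 H3.
  assert (H : forall g, cofinal_map a g <-> cofinal_map b g).
  { intros g. split; intros Hg; apply cofinal_map_elim in Hg; destruct Hg as (f & Hf1 & Hf2).
    - apply (cofinal_map_intro b g (fun e => F (f e))); [auto|].
      intros z Hz. destruct (H3 z Hz) as (x & Hx & Hzx).
      destruct (Hf2 x Hx) as (e & He & Hxe). exists e. split; [exact He|].
      pose proof (H2 x (f e) Hxe (Hf1 e He)). order.
    - destruct (choice (fun e x => e ≺ g -> x ≺ a /\ f e ≼ F x)) as [h Hh].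
      { intros e. destruct (classic (e ≺ g)) as [He|He]; [|exists e; easy].
        destruct (H3 (f e) (Hf1 e He)) as [x Hx]. eauto. }
      apply (cofinal_map_intro a g h); [apply Hh|].
      intros x Hx. destruct (Hb (F x) (H1 x Hx)) as (z & Hz & Hzb).
      destruct (Hf2 z Hzb) as (e & He & Hze). exists e. split; [exact He|].
      apply nltK. intros h'. destruct (Hh e He) as [_ Hfe].
      pose proof (H2 (h e) x (ltK_leK _ _ h') Hx). order. }
  intros g. unfold IsCf. fold (cofinal_map a g) (cofinal_map b g). rewrite H.
  split; intros [h1 h2]; (split; [exact h1|]); intros g' Hg' h; apply (h2 g' Hg'), H, h.
Qed.

Lemma cf_omega1 : IsCf lt omega1 omega1.
Proof.
  split; [apply cofinal_map_refl|]. intros g Hg [f Hf].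
  destruct (omega1_regular (below lt g) (fun e => proj1_sig (f e))) as (b & Hb & Hfb).
  - apply omega1_spec, Hg.
  - intros e. apply proj2_sig.
  - destruct (Hf b Hb) as [e He]. specialize (Hfb e). order.
Qed.

Lemma omega1_limit : IsLimit lt omega1.
Proof.
  split; [exists omega; apply omega_lt_omega1|]. intros b Hb.
  destruct (omega1_regular unit (fun _ => b)) as (c & Hc & Hbc); [|auto|].
  - exists (fun _ => 0). intros [] []. reflexivity.
  - exists c. split; [exact (Hbc tt)|exact Hc].
Qed.

(** Choose points of [D] increasing along [p]; their supremum lies in [D], and the enumeration
    transfers cofinality. *)
Lemma club_point_of_cf D p : Club lt D -> IsLimit lt p ->
  exists a, D a /\ forall g, IsCf lt p g <-> IsCf lt a g.
Proof.
  intros (_ & Dunb & Dcl) Hp.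
  set (d := wfrec lt ltK_wf lam
    (fun x f => least (fun z => D z /\ forall y, y ≺ x -> f y ≺ z))).
  assert (Hd : forall x, D (d x) /\ forall y, y ≺ x -> d y ≺ d x).
  { intros x.
    assert (E : d x = least (fun z => D z /\ forall y, y ≺ x -> d y ≺ z)).
    { apply (wfrec_eq lt ltK_wf lam
        (fun x f => least (fun z => D z /\ forall y, y ≺ x -> f y ≺ z))).
      clear. intros x f g H. f_equal. apply pred_ext. intros z.
      split; intros [Hz1 Hz]; (split; [exact Hz1|]); intros y Hy;
        [rewrite <- H|rewrite H]; auto. }
    rewrite E. apply (least_spec (fun z => D z /\ forall y, y ≺ x -> d y ≺ z)).
    destruct (bounded (below lt x) (fun y => d (proj1_sig y))) as [b Hb];
      [apply below_embeds_lam|].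
    destruct (Dunb b I) as (c & Hc & _ & Hbc). exists c. split; [exact Hc|].
    intros y Hy. specialize (Hb (exist _ y Hy)). cbn in Hb. order. }
  destruct Hp as [[p0 Hp0] Hp].
  destruct (bounded (below lt p) (fun y => d (proj1_sig y))) as [z Hz];
    [apply below_embeds_lam|].
  destruct (limit_sup (below lt p) (exist _ p0 Hp0) (fun y => d (proj1_sig y)) z)
    as (a & _ & Ha & Ha1 & Ha2); [|exact Hz|].
  { intros [x Hx]. destruct (Hp x Hx) as (y & Hxy & Hy). exists (exist _ y Hy).
    cbn. apply Hd, Hxy. }
  exists a. split.
  - apply Dcl; [exact I|apply Ha|]. intros x Hx.
    destruct (Ha2 x Hx) as [y Hy]. exists (d (proj1_sig y)).
    split; [apply Hd|]. split; [exact Hy|apply Ha1].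
  - apply (cf_transfer p a d).
    + apply Ha.
    + intros x Hx. exact (Ha1 (exist _ x Hx)).
    + intros x y [Hxy| ->] _; [left; apply Hd, Hxy|apply leK_refl].
    + intros x Hx. destruct (Ha2 x Hx) as [[y Hy] Hxy]. exists y.
      split; [exact Hy|left; exact Hxy].
Qed.

Lemma CfGtOmega_stationary : Stationary lt (CfGtOmega lt).
Proof.
  intros D HD. destruct (club_point_of_cf D omega1 HD omega1_limit) as (a & Ha & Hcf).
  exists a. split; [|exact Ha]. exists omega1. split; [apply Hcf, cf_omega1|].
  intros w Hw. apply IsOmega_le_omega in Hw. pose proof omega_lt_omega1. order.
Qed.

(** Both [omega] and [omega1] occur as cofinalities in every club, and at least one of them differs
    from the cofinality of [lam]. *)
Lemma CfNeq_stationary : Stationary lt (fun a => CfNeq lt a lam).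
Proof.
  intros D HD. destruct (classic (IsCf lt lam omega1)) as [Hlam|Hlam].
  - destruct (club_point_of_cf D omega HD omega_limit) as (a & Ha & Hcf).
    exists a. split; [|exact Ha]. intros g Hg Hg'. apply Hcf in Hg.
    apply cf_le with (2 := cofinal_map_refl omega) in Hg.
    assert (g = omega1) by exact (cf_unique _ _ _ Hg' Hlam).
    pose proof omega_lt_omega1. order.
  - destruct (club_point_of_cf D omega1 HD omega1_limit) as (a & Ha & Hcf).
    exists a. split; [|exact Ha]. intros g Hg Hg'. apply Hcf in Hg.
    assert (g = omega1) by exact (cf_unique _ _ _ Hg cf_omega1).
    subst. contradiction.
Qed.

Lemma CfGtOmega_bounded a (x : nat -> K) : CfGtOmega lt a -> (forall n, x n ≺ a) ->
  exists z, z ≺ a /\ forall n, x n ≺ z.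
Proof.
  intros (g & Hg & Homega) Hx. apply NNPP. intros N.
  specialize (Homega _ omega_IsOmega).
  destruct omega_spec as [Ho1 Ho2].
  (* [k] inverts [omega_seq], so that a cofinal sequence becomes a cofinal map with domain
     [omega]. *)
  destruct (choice (fun e n => e ≺ omega -> e = omega_seq n)) as [k Hk].
  { intros e. destruct (classic (e ≺ omega)) as [He|He]; [|exists 0; easy].
    destruct (Ho2 e He) as [n Hn]. eauto. }
  apply (cf_le a g omega) in Hg; [order|].
  apply (cofinal_map_intro a omega (fun e => x (k e))); [auto|].
  intros z Hz. apply NNPP. intros h. apply N. exists z. split; [exact Hz|].
  intros n. apply nleK. intros h'. apply h. exists (omega_seq n).
  split; [apply Ho1|].
  assert (n = k (omega_seq n)) as <-; [|exact h'].
  apply (increasing_seq_inj omega_seq); [intros; apply omega_seq_succ|].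
  apply Hk, Ho1.
Qed.

(* Half of the pairing function on [L] holds the bits of the coded family; the other half is free,
   and varying it yields unboundedly many codes of the same family. *)
Lemma codes (I : Type) : CH lt lam -> embeds I L ->
  exists c : K -> I -> K, forall h b, exists x, b ≺ x /\ forall t, c x t = h t.
Proof.
  intros (f & Hf & Hsurj) [q Hq].
  destruct lam_square as [p Hp].
  destruct (two_points L lam_uncountable) as (o & o' & Ho).
  destruct (choice (fun y X => f X = y) Hsurj) as [g Hg].
  assert (Hgf : forall X, g (f X) = X) by (intros X; apply Hf, Hg).
  exists (fun x t => f (fun z => g x (p (o, p (z, q t))))).
  intros h b.
  set (X Y := fun z => (exists x t, z = p (o, p (x, q t)) /\ g (h t) x) \/
                       (exists y, z = p (o', y) /\ Y y)).
  assert (HX : forall Y t, f (fun z => X Y (p (o, p (z, q t)))) = h t).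
  { intros Y t. rewrite <- (Hg (h t)). f_equal. apply pred_ext. intros x. unfold X. split.
    - intros [(x' & t' & E & H)|(y & E & _)].
      + apply Hp in E. injection E as E. apply Hp in E. injection E as -> E.
        apply Hq in E. subst. exact H.
      + apply Hp in E. congruence.
    - intros H. left. exists x, t. auto. }
  destruct (classic (exists Y, b ≺ f (X Y))) as [[Y HY]|N].
  { exists (f (X Y)). split; [exact HY|]. intros t. cbn.
    rewrite <- (HX Y t). rewrite Hgf. reflexivity. }
  (* If every code [f (X Y)] were at most [b], then, distinct [Y] giving distinct codes, [K] would
     embed below [b'] and hence into [lam]. *)
  exfalso. apply K_large. destruct (K_limit b) as [b' Hb'].
  apply embeds_trans with (2 := below_embeds_lam b').
  apply (embeds_below_rel b' (fun x y => y = f (X (g x)))).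
  - intros x. exists (f (X (g x))). split; [|reflexivity].
    apply NNPP. intros h'. apply N. exists (g x). order.
  - intros x x' y E E'. rewrite E' in E. apply Hf in E.
    rewrite <- (Hg x), <- (Hg x'). f_equal. apply pred_ext. intros y'.
    assert (HY : forall Y, X Y (p (o', y')) <-> Y y').
    { intros Y. unfold X. split.
      - intros [(x1 & t & E1 & _)|(y1 & E1 & H)]; apply Hp in E1; [congruence|].
        injection E1 as ->. exact H.
      - intros H. right. eauto. }
    rewrite <- HY, <- (HY (g x')). rewrite E. reflexivity.
Qed.

(** * Order types and greedy subsets *)

Definition greedy (P : K -> Prop) (Q : K -> K -> Prop) : K -> Prop :=
  wfrec lt ltK_wf True (fun x f => P x /\ forall y, y ≺ x -> f y -> Q y x).

Lemma greedy_eq P Q x :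
  greedy P Q x <-> P x /\ forall y, y ≺ x -> greedy P Q y -> Q y x.
Proof.
  unfold greedy at 1. rewrite wfrec_eq; [reflexivity|].
  clear x. intros x f g H. apply propositional_extensionality.
  split; intros [H1 H2]; (split; [exact H1|]); intros y Hy Hf; apply H2; auto;
    [rewrite H|rewrite <- H]; auto.
Qed.

(** Greedy selection looks only downwards; coherence of the spliced sequences rests on this
    locality. *)
Lemma greedy_ext P Q P' Q' b :
  (forall x, x ≺ b -> (P x <-> P' x)) ->
  (forall y x, x ≺ b -> (Q y x <-> Q' y x)) ->
  forall x, x ≺ b -> (greedy P Q x <-> greedy P' Q' x).
Proof.
  intros HP HQ x. induction x as [x IH] using (well_founded_ind ltK_wf). intros Hx.
  rewrite (greedy_eq P), (greedy_eq P'), HP by exact Hx.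
  split; intros [H1 H2]; (split; [exact H1|]); intros y Hy Hg;
    (apply HQ; [exact Hx|]); apply H2; try assumption; apply IH; auto; order.
Qed.

Lemma thin_out D A : Club lt D -> Cofinal lt A ->
  exists A', Cofinal lt A' /\ (forall x, A' x -> A x) /\
    forall x y, A' x -> A' y -> x ≺ y -> exists d, D d /\ x ≺ d /\ d ≺ y.
Proof.
  intros (_ & HD & _) HA.
  set (A' := greedy A (fun x y => exists d, D d /\ x ≺ d /\ d ≺ y)).
  assert (HA' : forall x, A' x <-> A x /\
    forall y, y ≺ x -> A' y -> exists d, D d /\ y ≺ d /\ d ≺ x)
    by (intros x; apply greedy_eq).
  exists A'. split; [|split].
  - intros b. apply NNPP. intros Nb.
    destruct (HD b I) as (d & Hd & _ & Hbd). destruct (HA d) as (x & Hx & Hdx).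
    apply Nb. exists x. split; [|order]. apply HA'. split; [exact Hx|].
    intros y Hy Hy'. exists d. split; [exact Hd|]. split; [|exact Hdx].
    apply NNPP. intros h. apply Nb. exists y. split; [exact Hy'|order].
  - intros x Hx. apply HA', Hx.
  - intros x y Hx Hy Hxy. apply HA' in Hy. destruct Hy as [_ Hy]. auto.
Qed.

Lemma restrict_wf (A : K -> Prop) : well_founded (fun y x => A y /\ y ≺ x).
Proof.
  intros x. induction x as [x IH] using (well_founded_ind ltK_wf).
  constructor. intros y [_ Hy]. exact (IH y Hy).
Qed.

(* [rk A x] is the order type of [A] below [x]. *)
Definition rk (A : K -> Prop) : K -> K := rank _ (restrict_wf A).

Lemma rk_le_self A x : rk A x ≼ x.
Proof.
  induction x as [x IH] using (well_founded_ind ltK_wf).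
  apply rank_lt. intros y [_ Hy]. fold (rk A y). specialize (IH y Hy). order.
Qed.

Lemma rk_bounded A x y : A y /\ y ≺ x -> rk A y ≺ x.
Proof. intros [_ Hy]. pose proof (rk_le_self A y). order. Qed.

Lemma rk_lt A x y : A y -> y ≺ x -> rk A y ≺ rk A x.
Proof.
  intros HA Hy. apply (rank_lt _ (restrict_wf A) x x); [apply rk_bounded|auto].
Qed.

Lemma rk_le A x y : x ≼ y -> rk A x ≼ rk A y.
Proof.
  intros Hxy. apply rank_lt. intros z [HA Hz]. apply rk_lt; [exact HA|order].
Qed.

Lemma rk_onto A x z : z ≺ rk A x -> exists y, A y /\ y ≺ x /\ rk A y = z.
Proof.
  intros Hz. destruct (rank_onto _ (restrict_wf A)) with (z := z) (x := x)
    as (y & [HA Hy] & E); eauto.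
  - intros a b c [H1 H2] [H3 H4]. split; [exact H1|order].
  - intros y _. exists y. apply rk_bounded.
Qed.

Lemma rk_ext A B x : (forall y, y ≺ x -> (A y <-> B y)) -> rk A x = rk B x.
Proof.
  induction x as [x IH] using (well_founded_ind ltK_wf). intros H.
  unfold rk. rewrite !rank_eq. fold (rk A) (rk B). f_equal. apply pred_ext. intros z.
  assert (E : forall y, y ≺ x -> rk A y = rk B y).
  { intros y Hy. apply (IH y Hy). intros w Hw. apply H. order. }
  split; intros Hz y [HA Hy]; [rewrite <- E|rewrite E]; auto; apply Hz;
    (split; [apply H|]); assumption.
Qed.

(** By induction, a strictly increasing map into [lam] dominates the order type below each point. *)
Lemma OtpLe_rk A x : OtpLe lt A lam -> rk A x ≼ lam.
Proof.
  intros [f Hf].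
  assert (H : forall y (h : A y), rk A y ≼ proj1_sig (f (exist _ y h))).
  { intros y. induction y as [y IH] using (well_founded_ind ltK_wf). intros h.
    apply rank_lt. intros z [HA Hz]. fold (rk A z). specialize (IH z Hz HA).
    specialize (Hf (exist _ z HA) (exist _ y h) Hz). order. }
  apply rank_lt. intros y [HA _]. fold (rk A y). specialize (H y HA).
  pose proof (proj2_sig (f (exist _ y HA))). cbn in *. order.
Qed.

Lemma OtpLe_map A B (phi : K -> K) :
  (forall x, A x -> B (phi x)) -> (forall x y, A x -> A y -> x ≺ y -> phi x ≺ phi y) ->
  OtpLe lt B lam -> OtpLe lt A lam.
Proof.
  intros H1 H2 [f Hf].
  exists (fun x => f (exist _ (phi (proj1_sig x)) (H1 _ (proj2_sig x)))).
  intros [x Hx] [y Hy] Hxy. apply Hf. cbn in *. auto.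
Qed.

(** * Splicing values into a square sequence *)

Section Square.
Context (C : K -> K -> Prop) (HC : SquareSeq lt lam C).

Lemma C_lt a x : IsLimit lt a -> C a x -> x ≺ a.
Proof. intros Ha. exact (proj1 (proj1 (HC a Ha)) x). Qed.

Lemma C_unbounded a x : IsLimit lt a -> x ≺ a -> exists c, C a c /\ x ≺ c.
Proof.
  intros Ha Hx. destruct (HC a Ha) as [(_ & H & _) _].
  destruct (H x Hx) as (c & Hc & _ & Hxc). eauto.
Qed.

Lemma Acc_C_intro a b : IsLimit lt a -> b ≺ a -> (exists x, x ≺ b) ->
  (forall x, x ≺ b -> exists c, C a c /\ x ≺ c /\ c ≺ b) -> Acc lt (C a) b.
Proof.
  intros Ha Hb Hne Hlim. split; [split; [apply C_unbounded; assumption|auto]|].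
  destruct (HC a Ha) as [(_ & _ & H) _]. apply H; assumption.
Qed.

Lemma Acc_C a b : IsLimit lt a -> Acc lt (C a) b ->
  b ≺ a /\ IsLimit lt b /\ (forall x, C b x <-> C a x /\ x ≺ b) /\
  (forall x, x ≼ b -> rk (C b) x = rk (C a) x) /\ rk (C b) b ≺ rk (C a) a.
Proof.
  intros Ha Hb. pose proof Hb as [(_ & Hne & Hlim) HCb].
  destruct (HC a Ha) as (_ & _ & Hcoh). specialize (Hcoh b Hb).
  assert (Hrk : forall x, x ≼ b -> rk (C b) x = rk (C a) x).
  { intros x Hx. apply rk_ext. intros y Hy. rewrite Hcoh.
    assert (y ≺ b) by order. intuition. }
  assert (Hba : b ≺ a) by (apply C_lt; assumption).
  repeat split; auto.
  - intros x Hx. destruct (Hlim x Hx) as (c & _ & Hc). eauto.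
  - apply Hcoh, H.
  - apply Hcoh, H.
  - apply Hcoh.
  - rewrite Hrk by apply leK_refl. apply rk_lt; assumption.
Qed.

Definition next (a x : K) : K := least (fun c => C a c /\ x ≺ c).

Lemma next_spec a x : IsLimit lt a -> x ≺ a ->
  C a (next a x) /\ x ≺ next a x /\ forall c, C a c -> x ≺ c -> next a x ≼ c.
Proof.
  intros Ha Hx. destruct (least_spec (fun c => C a c /\ x ≺ c)) as [[H1 H2] H3].
  - apply C_unbounded; assumption.
  - repeat split; auto.
Qed.

(** As a limit of [C a], the point [b] has elements of [C a] between [x] and itself, so the next
    point after [x] is already in [C b]. *)
Lemma next_coherent a b x : IsLimit lt a -> Acc lt (C a) b -> x ≺ b -> next b x = next a x.
Proof.
  intros Ha Hb Hx. destruct (Acc_C a b Ha Hb) as (Hba & HLb & Hcoh & _).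
  destruct (next_spec b x HLb Hx) as (H1 & H2 & H3).
  apply Hcoh in H1. destruct H1 as [H1 H4].
  symmetry. apply least_unique; [auto|]. intros c [Hc Hxc].
  destruct (classic (c ≺ b)) as [Hcb|Hcb]; [|order].
  apply H3; [apply Hcoh; auto|exact Hxc].
Qed.

Section Stage.
(** [th] is the order type of the points where guessing is attempted, [N a] the set of admissible
    guessers below [a], and [v x] the value guessed by [x]. *)
Context (th : K) (N : K -> K -> Prop) (v : K -> K).
Hypothesis N_lt : forall a x, N a x -> x ≺ a /\ v x ≺ x.
Hypothesis N_coherent : forall a b x, IsLimit lt a -> Acc lt (C a) b -> x ≺ b ->
  (N b x <-> N a x).

(* Consecutive elements of [G a] are separated by a value [v x] with [x] in [N a]. *)
Definition G (a : K) : K -> Prop :=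
  greedy (C a) (fun d g => exists x, N a x /\ x ≺ g /\ d ≺ v x).

Definition full (a : K) : Prop := forall x, x ≺ a -> exists g, G a g /\ x ≺ g.

Definition lim_G (a x : K) : Prop :=
  x ≺ a /\ (exists y, y ≺ x) /\ forall y, y ≺ x -> exists g, G a g /\ y ≺ g /\ g ≺ x.

(** Minimizing the guesser [x] rather than its value makes the choice coherent: a guesser with a
    smaller value might lie beyond an accumulation point [b], whereas the least guesser is below the
    next element of [G a]. *)
Definition w (a d : K) : K := v (least (fun x => N a x /\ d ≺ v x)).

(** One value is inserted after each element of [G a], and the limits of [G a] are added: the limits
    become the accumulation points and the values the nonaccumulation points. *)
Definition Cfull (a x : K) : Prop := lim_G a x \/ exists d, G a d /\ x = w a d.

(* The first clause keeps points of order type [th] from being accumulation points of any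
   member of the new sequence. *)
Definition C' (a x : K) : Prop :=
  IsLimit lt a /\
  ((th ≺ rk (C a) a /\ C a x /\ th ≼ rk (C a) x) \/
   (rk (C a) a ≼ th /\ full a /\ Cfull a x) \/
   (rk (C a) a ≼ th /\ ~ full a /\ C a x /\ forall d, G a d -> d ≺ x)).

Lemma G_C a x : G a x -> C a x.
Proof. unfold G. rewrite greedy_eq. intros [H _]. exact H. Qed.

Lemma G_step a d g : G a d -> G a g -> d ≺ g -> exists x, N a x /\ x ≺ g /\ d ≺ v x.
Proof.
  intros Hd Hg. unfold G in Hg. rewrite greedy_eq in Hg. destruct Hg as [_ H].
  intros Hdg. exact (H d Hdg Hd).
Qed.

Lemma G_coherent a b x : IsLimit lt a -> Acc lt (C a) b -> x ≺ b -> (G b x <-> G a x).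
Proof.
  intros Ha Hb Hx. destruct (Acc_C a b Ha Hb) as (Hba & HLb & Hcoh & _).
  apply greedy_ext with (b := b); [| |exact Hx].
  - intros y Hy. rewrite Hcoh. intuition.
  - intros d g Hg. split; intros (y & H1 & H2 & H3); exists y;
      (split; [apply (N_coherent a b y Ha Hb); [order|exact H1]|auto]).
Qed.

Lemma values_full a : IsLimit lt a ->
  (forall x, x ≺ a -> exists y, N a y /\ x ≺ v y) -> full a.
Proof.
  intros Ha H. intros x Hx. apply NNPP. intros Nx.
  destruct (H x Hx) as (y & Hy & Hxy). destruct (N_lt a y Hy) as [Hya Hvy].
  destruct (C_unbounded a y Ha Hya) as (c & Hc & Hyc).
  apply Nx. exists c. split; [|order].
  unfold G. rewrite greedy_eq. split; [exact Hc|]. intros d Hd HG.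
  exists y. split; [exact Hy|]. split; [exact Hyc|].
  apply NNPP. intros h. apply Nx. exists d. split; [exact HG|order].
Qed.

Lemma w_spec a d g : G a d -> G a g -> d ≺ g ->
  d ≺ w a d /\ w a d ≺ g /\ exists x, N a x /\ w a d = v x.
Proof.
  intros Hd Hg Hdg. destruct (G_step a d g Hd Hg Hdg) as (x & Hx & Hxg & Hdx).
  destruct (least_spec (fun x => N a x /\ d ≺ v x)) as [[H1 H2] H3]; [eauto|].
  unfold w. split; [exact H2|]. split; [|eauto].
  specialize (H3 x (conj Hx Hdx)). destruct (N_lt _ _ H1) as [_ H4]. order.
Qed.

Lemma w_coherent a b d g : IsLimit lt a -> Acc lt (C a) b -> G a d -> G a g ->
  d ≺ g -> g ≺ b -> w b d = w a d.
Proof.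
  intros Ha Hb Hd Hg Hdg Hgb. unfold w. f_equal.
  destruct (G_step a d g Hd Hg Hdg) as (x & Hx & Hxg & Hdx).
  destruct (least_spec (fun x => N a x /\ d ≺ v x)) as [[H1 H2] H3]; [eauto|].
  pose proof (H3 x (conj Hx Hdx)) as H4.
  apply least_unique.
  - split; [|exact H2]. apply (N_coherent a b _ Ha Hb); [order|exact H1].
  - intros y [Hy Hdy]. destruct (N_lt _ _ Hy) as [Hyb _].
    apply H3. split; [|exact Hdy]. apply (N_coherent a b _ Ha Hb); [order|exact Hy].
Qed.

Section Full.
Context (a : K) (Ha : IsLimit lt a) (Hfull : full a).

Lemma G_next d : G a d -> exists g, G a g /\ d ≺ g.
Proof. intros Hd. apply Hfull, C_lt, G_C; assumption. Qed.

(** Inserted values interleave with [G a]. Hence, if [y] is the value inserted after [d], no point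
    of [Cfull a] lies strictly between [d] and [y], and [d] itself separates. Both the description
    of limits and the bound on the order type come from this. *)
Lemma Cfull_between x y : Cfull a x -> Cfull a y -> x ≺ y ->
  exists g, G a g /\ x ≼ g /\ g ≺ y.
Proof.
  intros Hx [(_ & _ & Hy)|(d & Hd & ->)] Hxy.
  { destruct (Hy x Hxy) as (g & Hg & H1 & H2). exists g. split; [exact Hg|]. split; order. }
  destruct (G_next d Hd) as (g & Hg & Hdg).
  destruct (w_spec a d g Hd Hg Hdg) as (H1 & H2 & _).
  exists d. split; [exact Hd|]. split; [|exact H1].
  apply nltK. intros Hdx.
  destruct Hx as [(_ & _ & Hx)|(d' & Hd' & ->)].
  - destruct (Hx d Hdx) as (g' & Hg' & H3 & H4).
    destruct (w_spec a d g' Hd Hg' H3) as (_ & H5 & _). order.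
  - destruct (ltK_total d' d) as [h|[->|h]]; [|order|].
    + destruct (w_spec a d' d Hd' Hd h) as (_ & H5 & _). order.
    + destruct (w_spec a d d' Hd Hd' h) as (_ & H5 & _).
      destruct (G_next d' Hd') as (g' & Hg' & Hdg').
      destruct (w_spec a d' g' Hd' Hg' Hdg') as (H6 & _). order.
Qed.

Lemma Cfull_lt x : Cfull a x -> x ≺ a.
Proof.
  intros [Hx|(d & Hd & ->)]; [apply Hx|]. destruct (G_next d Hd) as (g & Hg & Hdg).
  destruct (w_spec a d g Hd Hg Hdg) as (_ & H & _).
  pose proof (C_lt a g Ha (G_C a g Hg)). order.
Qed.

Lemma Cfull_unbounded x : x ≺ a -> exists y, Cfull a y /\ x ≺ y.
Proof.
  intros Hx. destruct (Hfull x Hx) as (d & Hd & Hxd).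
  destruct (G_next d Hd) as (g & Hg & Hdg).
  destruct (w_spec a d g Hd Hg Hdg) as (H & _).
  exists (w a d). split; [right; eauto|order].
Qed.

Lemma Cfull_limit b : b ≺ a -> (exists x, x ≺ b) ->
  (forall x, x ≺ b -> exists y, Cfull a y /\ x ≺ y /\ y ≺ b) -> lim_G a b.
Proof.
  intros Hb Hne H. split; [exact Hb|]. split; [exact Hne|]. intros x Hx.
  destruct (H x Hx) as (y & Hy & Hxy & Hyb).
  destruct (H y Hyb) as (z & Hz & Hyz & Hzb).
  destruct (Cfull_between y z Hy Hz Hyz) as (g & Hg & H1 & H2).
  exists g. split; [exact Hg|]. split; order.
Qed.

Lemma lim_G_Acc b : lim_G a b -> Acc lt (C a) b.
Proof.
  intros (H1 & H2 & H3). apply Acc_C_intro; auto.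
  intros x Hx. destruct (H3 x Hx) as (g & Hg & H). exists g. split; [apply G_C, Hg|exact H].
Qed.

Lemma Acc_Cfull b : Acc lt (Cfull a) b -> lim_G a b.
Proof.
  intros [(_ & Hne & H) Hb]. apply Cfull_limit; auto. apply Cfull_lt, Hb.
Qed.

Lemma lim_G_w b x : lim_G a b -> x ≺ b -> exists d, G a d /\ x ≺ w a d /\ w a d ≺ b.
Proof.
  intros (_ & _ & H) Hx. destruct (H x Hx) as (d & Hd & Hxd & Hdb).
  destruct (H d Hdb) as (g & Hg & Hdg & Hgb).
  destruct (w_spec a d g Hd Hg Hdg) as (H1 & H2 & _).
  exists d. split; [exact Hd|]. split; order.
Qed.

Lemma NAcc_Cfull x : NAcc lt (Cfull a) x -> exists y, N a y /\ x = v y.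
Proof.
  intros [Hx Hn]. destruct Hx as [Hx|(d & Hd & ->)].
  - exfalso. apply Hn. split; [|left; exact Hx]. split; [|split].
    + apply Cfull_unbounded, Hx.
    + apply Hx.
    + intros y Hy. destruct (lim_G_w x y Hx Hy) as (d & Hd & H).
      exists (w a d). split; [right; eauto|exact H].
  - destruct (G_next d Hd) as (g & Hg & Hdg).
    destruct (w_spec a d g Hd Hg Hdg) as (_ & _ & H). exact H.
Qed.

Lemma Cfull_OtpLe : OtpLe lt (Cfull a) lam.
Proof.
  (* Rounding up to [G a] is strictly increasing, since an element of [G a] separates any two points
     of [Cfull a]. *)
  set (phi x := least (fun g => G a g /\ x ≼ g)).
  assert (Hphi : forall x, Cfull a x -> (G a (phi x) /\ x ≼ phi x) /\
    forall g, G a g /\ x ≼ g -> phi x ≼ g).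
  { intros x Hx. apply (least_spec (fun g => G a g /\ x ≼ g)).
    destruct (Hfull x (Cfull_lt x Hx)) as (g & Hg & Hxg). exists g. split; [exact Hg|order]. }
  apply (OtpLe_map (Cfull a) (C a) phi); [| |apply (HC a Ha)].
  - intros x Hx. apply G_C, Hphi, Hx.
  - intros x y Hx Hy Hxy. destruct (Cfull_between x y Hx Hy Hxy) as (g & Hg & H1 & H2).
    destruct (Hphi x Hx) as [_ H3]. destruct (Hphi y Hy) as [[_ H4] _].
    specialize (H3 g (conj Hg H1)). order.
Qed.

Lemma Cfull_club : ClubBelow lt a (Cfull a).
Proof.
  split; [|split].
  - apply Cfull_lt.
  - intros x Hx. destruct (Cfull_unbounded x Hx) as (y & Hy & Hxy).
    exists y. split; [exact Hy|]. split; [apply Cfull_lt, Hy|exact Hxy].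
  - intros c Hc Hne H. left. apply Cfull_limit; assumption.
Qed.

Lemma full_coherent b : lim_G a b -> full b.
Proof.
  intros Hb x Hx. pose proof Hb as (_ & _ & H). destruct (H x Hx) as (g & Hg & Hxg & Hgb).
  exists g. split; [|exact Hxg]. apply (G_coherent a b g Ha); [|assumption|assumption].
  apply lim_G_Acc, Hb.
Qed.

Lemma Cfull_coherent b x : lim_G a b -> (Cfull b x <-> Cfull a x /\ x ≺ b).
Proof.
  intros Hb. pose proof (lim_G_Acc b Hb) as Hacc.
  pose proof Hb as (Hba & _ & Hlim).
  assert (HG : forall g, g ≺ b -> (G b g <-> G a g)).
  { intros g. apply G_coherent; assumption. }
  assert (Hw : forall d, G a d -> d ≺ b -> w b d = w a d /\ w a d ≺ b /\ d ≺ w a d).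
  { intros d Hd Hdb. destruct (Hlim d Hdb) as (g & Hg & Hdg & Hgb).
    split; [apply (w_coherent a b d g); assumption|].
    destruct (w_spec a d g Hd Hg Hdg) as (H1 & H2 & _). split; order. }
  assert (HLb : IsLimit lt b) by apply (Acc_C a b Ha Hacc).
  split.
  - intros [(H1 & H2 & H3)|(d & Hd & ->)].
    + split; [left|exact H1]. split; [order|]. split; [exact H2|].
      intros y Hy. destruct (H3 y Hy) as (g & Hg & Hyg & Hgx). exists g.
      split; [apply HG; [order|exact Hg]|auto].
    + pose proof (C_lt b d HLb (G_C b d Hd)) as Hdb.
      apply HG in Hd; [|exact Hdb]. destruct (Hw d Hd Hdb) as (-> & H1 & H2).
      split; [right; eauto|exact H1].
  - intros [[(H1 & H2 & H3)|(d & Hd & ->)] Hxb].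
    + left. split; [exact Hxb|]. split; [exact H2|].
      intros y Hy. destruct (H3 y Hy) as (g & Hg & Hyg & Hgx). exists g.
      split; [apply HG; [order|exact Hg]|auto].
    + assert (Hdb : d ≺ b).
      { destruct (G_next d Hd) as (g & Hg & Hdg).
        destruct (w_spec a d g Hd Hg Hdg) as (H & _). order. }
      destruct (Hw d Hd Hdb) as (E & _ & _). right. exists d.
      split; [apply HG; assumption|auto].
Qed.

End Full.

Lemma C'_cut a x : IsLimit lt a -> th ≺ rk (C a) a ->
  (C' a x <-> C a x /\ th ≼ rk (C a) x).
Proof.
  intros Ha Hth. split.
  - intros [_ [H|[[H _]|[H _]]]]; [apply H|order|order].
  - intros H. split; [exact Ha|]. left. auto.
Qed.

Lemma C'_full a x : IsLimit lt a -> rk (C a) a ≼ th -> full a -> (C' a x <-> Cfull a x).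
Proof.
  intros Ha Hth Hfull. split.
  - intros [_ [[H _]|[H|H]]]; [order|apply H|]. destruct H as (_ & H & _). contradiction.
  - intros H. split; [exact Ha|]. right. left. auto.
Qed.

Lemma C'_bounded a x : IsLimit lt a -> rk (C a) a ≼ th -> ~ full a ->
  (C' a x <-> C a x /\ forall d, G a d -> d ≺ x).
Proof.
  intros Ha Hth Hfull. split.
  - intros [_ [[H _]|[H|H]]]; [order| |apply H]. destruct H as (_ & H & _). contradiction.
  - intros H. split; [exact Ha|]. right. right. auto.
Qed.

Lemma Acc_C_sub a (B : K -> Prop) b : IsLimit lt a -> (forall x, B x -> C a x) ->
  Acc lt B b -> Acc lt (C a) b.
Proof.
  intros Ha HB [(_ & Hne & H) Hb]. apply Acc_C_intro; auto.
  - apply C_lt; auto.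
  - intros x Hx. destruct (H x Hx) as (c & Hc & Hxc). eauto.
Qed.

Lemma Acc_ext (A B : K -> Prop) b : (forall x, A x <-> B x) -> Acc lt A b -> Acc lt B b.
Proof. intros H. rewrite (pred_ext A B H). exact (fun h => h). Qed.

(** Accumulation points of a cut set lie beyond an element at position at least [th]; in the other
    two cases [b] is an accumulation point of [C a], so its order type is below that of [a], which
    is at most [th]. *)
Lemma C'_order_type a b : IsLimit lt a -> Acc lt (C' a) b -> rk (C b) b <> th.
Proof.
  intros Ha Hb.
  destruct (classic (th ≺ rk (C a) a)) as [Hth|Hth].
  - apply (Acc_ext _ _ b (fun x => C'_cut a x Ha Hth)) in Hb.
    pose proof (Acc_C_sub a _ b Ha (fun x => @proj1 _ _) Hb) as Hb'.
    destruct Hb as [(_ & [x0 Hx0] & H) _]. destruct (H x0 Hx0) as (x & [Hx Hthx] & _ & Hxb).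
    destruct (Acc_C a b Ha Hb') as (_ & _ & _ & E & _).
    rewrite E by apply leK_refl. pose proof (rk_lt (C a) b x Hx Hxb). order.
  - apply nltK in Hth. assert (Hb' : Acc lt (C a) b).
    { destruct (classic (full a)) as [Hf|Hf].
      - apply lim_G_Acc; [exact Ha|]. apply Acc_Cfull; [exact Ha|exact Hf|].
        exact (Acc_ext _ _ b (fun x => C'_full a x Ha Hth Hf) Hb).
      - apply (Acc_ext _ _ b (fun x => C'_bounded a x Ha Hth Hf)) in Hb.
        exact (Acc_C_sub a _ b Ha (fun x => @proj1 _ _) Hb). }
    destruct (Acc_C a b Ha Hb') as (_ & _ & _ & _ & H). order.
Qed.

Lemma subset_OtpLe a (B : K -> Prop) : IsLimit lt a -> (forall x, B x -> C a x) ->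
  OtpLe lt B lam.
Proof.
  intros Ha H. apply (OtpLe_map B (C a) (fun x => x)); [exact H|auto|apply (HC a Ha)].
Qed.

Lemma final_segment_club a (U : K -> Prop) : IsLimit lt a ->
  (forall x y, U x -> x ≺ y -> U y) -> (exists x, C a x /\ U x) ->
  ClubBelow lt a (fun x => C a x /\ U x).
Proof.
  intros Ha HU [x0 [Hx0 HU0]]. split; [|split].
  - intros x [Hx _]. apply C_lt; assumption.
  - intros b Hb. set (m := maxK b x0).
    assert (Hm : m ≺ a).
    { pose proof (C_lt a x0 Ha Hx0). unfold m, maxK.
      destruct (excluded_middle_informative (b ≺ x0)); assumption. }
    assert (H : b ≼ m /\ x0 ≼ m) by apply maxK_spec, leK_refl. destruct H as [H1 H2].
    destruct (C_unbounded a m Ha Hm) as (c & Hc & Hmc).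
    exists c. split; [split; [exact Hc|]|split; [apply C_lt; assumption|order]].
    apply (HU x0); [exact HU0|order].
  - intros c Hc Hne H. split.
    + apply (Acc_C_intro a c Ha Hc Hne). intros x Hx.
      destruct (H x Hx) as (d & [Hd _] & Hxd). eauto.
    + destruct Hne as [x Hx]. destruct (H x Hx) as (d & [_ Hd] & _ & Hdc). eauto.
Qed.

(** An accumulation point [b] falls under the same clause as [a]. In the cut case its order type
    exceeds [th]; in the full case it is a limit of [G a], so [G b] is unbounded; in the remaining
    case some [y ≺ b] lies above all of [G a], so [G b] is bounded. *)
Lemma C'_square : SquareSeq lt lam C'.
Proof.
  intros a Ha. destruct (classic (th ≺ rk (C a) a)) as [Hth|Hth];
    [|apply nltK in Hth; destruct (classic (full a)) as [Hf|Hf]].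
  - rewrite (pred_ext (C' a) _ (fun x => C'_cut a x Ha Hth)). split; [|split].
    + apply final_segment_club; [exact Ha| |].
      * intros x y Hx Hxy. pose proof (rk_le (C a) x y (ltK_leK _ _ Hxy)). order.
      * destruct (rk_onto (C a) a th Hth) as (y & Hy & _ & E).
        exists y. split; [exact Hy|right; auto].
    + apply (subset_OtpLe a); [exact Ha|]. intros x [H _]. exact H.
    + intros b Hb x.
      pose proof (Acc_C_sub a _ b Ha (fun x => @proj1 _ _) Hb) as Hb'.
      destruct (Acc_C a b Ha Hb') as (_ & HLb & Hcoh & Hrk & _).
      destruct Hb as [(_ & [y0 Hy0] & H) _]. destruct (H y0 Hy0) as (y & [Hy Hthy] & _ & Hyb).
      pose proof (rk_lt (C a) b y Hy Hyb) as Hyrk.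
      pose proof (Hrk b (leK_refl b)) as Hrkb.
      rewrite (C'_cut b x HLb) by order. rewrite Hcoh.
      split; [intros [[H1 H2] H3]|intros [[H1 H3] H2]];
        [rewrite Hrk in H3 by order|rewrite Hrk by order]; auto.
  - rewrite (pred_ext (C' a) _ (fun x => C'_full a x Ha Hth Hf)). split; [|split].
    + apply Cfull_club; assumption.
    + apply Cfull_OtpLe; assumption.
    + intros b Hb x. apply Acc_Cfull in Hb; [|assumption|assumption].
      pose proof (lim_G_Acc a Ha b Hb) as Hb'.
      destruct (Acc_C a b Ha Hb') as (_ & HLb & _ & _ & Hrk).
      rewrite (C'_full b x HLb); [|order|apply (full_coherent a Ha b Hb)].
      apply Cfull_coherent; assumption.
  - rewrite (pred_ext (C' a) _ (fun x => C'_bounded a x Ha Hth Hf)). split; [|split].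
    + apply final_segment_club; [exact Ha| |].
      * intros x y Hx Hxy d Hd. specialize (Hx d Hd). order.
      * apply not_all_ex_not in Hf. destruct Hf as [z Hz].
        apply imply_to_and in Hz. destruct Hz as [Hz HG].
        destruct (C_unbounded a z Ha Hz) as (c & Hc & Hzc). exists c. split; [exact Hc|].
        intros d Hd. apply nleK. intros h. apply HG. exists d. split; [exact Hd|order].
    + apply (subset_OtpLe a); [exact Ha|]. intros x [H _]. exact H.
    + intros b Hb x.
      pose proof (Acc_C_sub a _ b Ha (fun x => @proj1 _ _) Hb) as Hb'.
      destruct (Acc_C a b Ha Hb') as (_ & HLb & Hcoh & _ & Hrk).
      destruct Hb as [(_ & [y0 Hy0] & H) [_ HGb]].
      destruct (H y0 Hy0) as (y & [Hy HGy] & _ & Hyb).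
      rewrite (C'_bounded b x HLb); [|order|].
      * rewrite Hcoh. split.
        -- intros [[H1 H2] H3]. split; [split; [exact H1|]|exact H2].
           intros d Hd. apply H3. apply (G_coherent a b d Ha Hb'); auto.
        -- intros [[H1 H3] H2]. split; [auto|]. intros d Hd. apply H3.
           apply (G_coherent a b d Ha Hb'); [|exact Hd]. apply (C_lt b d HLb), G_C, Hd.
      * intros Hfb. destruct (Hfb y Hyb) as (g & Hg & Hyg).
        apply (G_coherent a b g Ha Hb') in Hg; [|apply (C_lt b g HLb), G_C, Hg].
        specialize (HGy g Hg). order.
Qed.

(** The guessing points are those of [S] that have order type [th] and unboundedly many values. If
    no [A] were a counterexample, each cofinal set would contain all values from [N a] at some such
    [a]; there [G a] is unbounded and [C' a] consists of values and their limits. *)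
Lemma stage (S : K -> Prop) : ~ ClubSquare lt lam S ->
  exists A, Cofinal lt A /\ forall a, S a -> IsLimit lt a -> rk (C a) a = th ->
    (forall x, x ≺ a -> exists y, N a y /\ x ≺ v y) -> exists y, N a y /\ ~ A (v y).
Proof.
  intros HS. apply NNPP. intros HN. apply HS.
  exists C', (fun a => S a /\ IsLimit lt a /\ rk (C a) a = th /\
    forall x, x ≺ a -> exists y, N a y /\ x ≺ v y).
  split; [exact C'_square|]. split; [intros x H; apply H|]. split.
  - intros D A HD HA. destruct (thin_out D A HD HA) as (A' & HA1 & HA2 & HA3).
    assert (Ha : exists a, (S a /\ IsLimit lt a /\ rk (C a) a = th /\
      forall x, x ≺ a -> exists y, N a y /\ x ≺ v y) /\ forall y, N a y -> A' (v y)).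
    { apply NNPP. intros h. apply HN. exists A'. split; [exact HA1|].
      intros a H1 H2 H3 H4. apply NNPP. intros h'. apply h. exists a.
      split; [auto|]. intros y Hy. apply NNPP. intros h''. apply h'. eauto. }
    destruct Ha as (a & (HSa & Ha & Hth & Hv) & HA').
    exists a. split; [auto|].
    assert (Hf : full a) by (apply values_full; assumption).
    rewrite (pred_ext (C' a) (Cfull a)); [|intros; apply C'_full; auto; right; auto].
    assert (HwA : forall d, G a d -> A' (w a d)).
    { intros d Hd. destruct (G_next a Ha Hf d Hd) as (g & Hg & Hdg).
      destruct (w_spec a d g Hd Hg Hdg) as (_ & _ & y & Hy & ->). auto. }
    split.
    + intros b Hb. apply Acc_Cfull in Hb; [|assumption|assumption].
      destruct HD as (_ & _ & HD). apply HD; [exact I|apply Hb|]. intros x Hx.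
      destruct (lim_G_w a b x Hb Hx) as (d & Hd & Hxd & Hdb).
      destruct (lim_G_w a b (w a d) Hb Hdb) as (g & Hg & Hdg & Hgb).
      destruct (HA3 _ _ (HwA d Hd) (HwA g Hg) Hdg) as (z & Hz & Hz1 & Hz2).
      exists z. split; [exact Hz|]. split; order.
    + intros x Hx. apply NAcc_Cfull in Hx; [|assumption|assumption].
      destruct Hx as (y & Hy & ->). auto.
  - intros a x (_ & Hx & Hth & _) Hacc.
    destruct (classic (IsLimit lt a)) as [Ha|Ha].
    + exact (C'_order_type a x Ha Hacc Hth).
    (* At a nonlimit [a] the set [C' a] is empty. *)
    + destruct Hacc as [_ [H _]]. contradiction.
Qed.

End Stage.

(** * The recursion of counterexamples *)

Section Main.
Context (ind : K -> K -> K).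
Hypothesis ind_spec : forall g x, x ≺ g ->
  ind g x ≺ lam /\ forall y, y ≺ g -> ind g x = ind g y -> x = y.

(* [idx a x] depends only on [x] and the next point of [C a], hence is coherent. *)
Definition idx (a x : K) : K := ind (next a x) x.

Lemma idx_lt a x : IsLimit lt a -> x ≺ a -> idx a x ≺ lam.
Proof. intros Ha Hx. apply ind_spec, next_spec; assumption. Qed.

(** A point [x] is determined by the position of [next a x] in [C a] and the index of [x] there;
    this leaves fewer than [lam] possibilities. *)
Lemma idx_small a j (Y : L -> K) : IsLimit lt a -> rk (C a) a ≺ lam -> j ≺ lam ->
  (forall i, Y i ≺ a /\ idx a (Y i) ≼ j) -> ~ injective_fun Y.
Proof.
  (* [j'] turns the weak bound [j] into a strict one. *)
  intros Ha Hrk Hj HY Hinj. destruct (lam_limit j Hj) as (j' & Hjj & Hj').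
  apply (lam_not_embeds_prod (below lt (rk (C a) a)) (below lt j') (rk (C a) a) j');
    [exact Hrk|exact Hj'|apply embeds_refl|apply embeds_refl|].
  apply (embeds_rel (fun i p => rk (C a) (next a (Y i)) = proj1_sig (fst p) /\
                                idx a (Y i) = proj1_sig (snd p))).
  - intros i. destruct (HY i) as [H1 H2].
    destruct (next_spec a (Y i) Ha H1) as (H3 & _ & _).
    assert (H4 : rk (C a) (next a (Y i)) ≺ rk (C a) a)
      by (apply rk_lt; [exact H3|apply C_lt; assumption]).
    assert (H5 : idx a (Y i) ≺ j') by order.
    exists (exist (fun z => z ≺ rk (C a) a) _ H4, exist (fun z => z ≺ j') _ H5). auto.
  - intros i i' p [E1 E2] [F1 F2]. apply Hinj.
    destruct (HY i) as [H1 _]. destruct (HY i') as [H1' _].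
    destruct (next_spec a (Y i) Ha H1) as (H3 & H4 & _).
    destruct (next_spec a (Y i') Ha H1') as (H3' & H4' & _).
    assert (En : next a (Y i) = next a (Y i')).
    { rewrite <- F1 in E1. destruct (ltK_total (next a (Y i)) (next a (Y i'))) as [h|[h|h]];
        [|exact h|]; apply (rk_lt (C a)) in h; auto; order. }
    unfold idx in E2, F2. rewrite <- En in F2, H4'.
    apply (ind_spec _ _ H4); [exact H4'|congruence].
Qed.

Context (c : K -> L * L * L -> K).
Hypothesis c_spec : forall h b, exists x, b ≺ x /\ forall t, c x t = h t.

Context (S : K -> Prop).
Hypothesis HS : ~ ClubSquare lt lam S.

(** The value [c x (th, j, i)] is the guess of [x] for the [i]-th counterexample in the run with
    parameters [th] and [j]. This is the family [N] of stage [i]; it reads [A] only at earlier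
    indices, which permits recursion on [i]. *)
Definition guess_dom (th j : L) (A : L -> K -> Prop) (i : L) (a x : K) : Prop :=
  x ≺ a /\ idx a x ≼ proj1_sig j /\ c x (th, j, i) ≺ x /\
  forall i', proj1_sig i' ≺ proj1_sig i -> A i' (c x (th, j, i')).

Definition refutes (th j : L) (A : L -> K -> Prop) (i : L) (B : K -> Prop) : Prop :=
  Cofinal lt B /\ forall a, S a -> IsLimit lt a -> rk (C a) a = proj1_sig th ->
    (forall x, x ≺ a -> exists y, guess_dom th j A i a y /\ x ≺ c y (th, j, i)) ->
    exists y, guess_dom th j A i a y /\ ~ B (c y (th, j, i)).

Lemma refutes_exists th j A i : exists B, refutes th j A i B.
Proof.
  apply (stage (proj1_sig th) (guess_dom th j A i) (fun x => c x (th, j, i))); [| |exact HS].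
  - intros a x (H1 & _ & H3 & _). auto.
  - intros a b x Ha Hb Hx. destruct (Acc_C a b Ha Hb) as (Hba & _).
    unfold guess_dom, idx. rewrite (next_coherent a b x Ha Hb Hx).
    assert (x ≺ a) by order. tauto.
Qed.

Lemma ltL_wf : well_founded (fun i' i : L => proj1_sig i' ≺ proj1_sig i).
Proof. exact (wf_inverse_image _ _ _ (@proj1_sig _ _) ltK_wf). Qed.

Definition counter (th j : L) : L -> K -> Prop :=
  wfrec _ ltL_wf (fun _ => True)
    (fun i A => epsilon (inhabits (fun _ => True)) (refutes th j A i)).

Lemma counter_spec th j i : refutes th j (counter th j) i (counter th j i).
Proof.
  assert (E : counter th j i =
    epsilon (inhabits (fun _ => True)) (refutes th j (counter th j) i)).
  { apply (wfrec_eq _ ltL_wf (fun _ => True)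
      (fun i A => epsilon (inhabits (fun _ => True)) (refutes th j A i))).
    clear. intros i A B H. f_equal.
    assert (Hdom : guess_dom th j A i = guess_dom th j B i).
    { apply functional_extensionality. intros a. apply pred_ext. intros x. unfold guess_dom.
      split; intros (H1 & H2 & H3 & H4); repeat (split; [assumption|]); intros i' Hi';
        [rewrite <- H|rewrite H]; auto. }
    unfold refutes. rewrite Hdom. reflexivity. }
  rewrite E. apply epsilon_spec, refutes_exists.
Qed.

(** All runs are guessed simultaneously, so a single club of [good_points] serves before the order
    type and the index bound are known. *)
Definition good (b x : K) : Prop :=
  forall th j i, counter th j i (c x (th, j, i)) /\ c x (th, j, i) ≺ x /\
                 b ≺ c x (th, j, i).

(** Pick a point above [b] in every counterexample. There are only [lam] many, so they have a common
    bound, and some [x] beyond it codes the whole choice. *)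
Lemma good_exists b : exists x, good b x.
Proof.
  destruct (choice (fun (t : L * L * L) y =>
    counter (fst (fst t)) (snd (fst t)) (snd t) y /\ b ≺ y)) as [h Hh].
  { intros t. apply counter_spec. }
  destruct (bounded _ h) as [z Hz].
  { apply embeds_trans with (2 := lam_square).
    apply embeds_prod; [exact lam_square|apply embeds_refl]. }
  destruct (c_spec h z) as (x & Hx & Hcx). exists x. intros th j i. rewrite Hcx.
  specialize (Hh (th, j, i)). specialize (Hz (th, j, i)). cbn in Hh.
  destruct Hh as [Hh1 Hh2]. split; [exact Hh1|]. split; [order|exact Hh2].
Qed.

Lemma good_mono b b' x : b ≼ b' -> good b' x -> good b x.
Proof.
  intros Hb H th j i. destruct (H th j i) as (H1 & H2 & H3).
  split; [exact H1|]. split; [exact H2|order].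
Qed.

Definition good_points (a : K) : Prop :=
  IsLimit lt a /\ forall b, b ≺ a -> exists x, x ≺ a /\ good b x.

Lemma good_points_club : Club lt good_points.
Proof.
  split; [auto|split].
  - intros b _. destruct (omega_chain (fun _ => True) (fun y z => exists x, x ≺ z /\ good y x))
      with (b := b) as (s & Hs0 & Hs); [|exact I|].
    { intros y _. destruct (good_exists y) as [x Hx].
      destruct (K_limit (maxK y x)) as [z Hz].
      assert (H : y ≼ maxK y x /\ x ≼ maxK y x) by apply maxK_spec, leK_refl.
      destruct H. exists z. split; [exact I|]. split; [order|]. exists x. split; [order|exact Hx]. }
    destruct (bounded nat s nat_embeds_lam) as [z Hz].
    destruct (limit_sup nat 0 s z) as (a & _ & Ha & Ha1 & Ha2); [|exact Hz|].
    { intros n. exists (Datatypes.S n). apply Hs. }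
    exists a. split; [|split; [exact I|rewrite <- Hs0; apply Ha1]].
    split; [exact Ha|]. intros y Hy. destruct (Ha2 y Hy) as [n Hn].
    destruct (Hs n) as (_ & _ & x & Hx & Hgood). exists x.
    specialize (Ha1 (Datatypes.S n)). split; [order|].
    apply (good_mono y (s n)); [order|exact Hgood].
  - intros a _ Hne H. split.
    + split; [exact Hne|]. intros b Hb. destruct (H b Hb) as (d & _ & Hd). eauto.
    + intros b Hb. destruct (H b Hb) as (d & [_ Hd] & Hbd & Hda).
      destruct (Hd b Hbd) as (x & Hx & Hgood). exists x. split; [order|exact Hgood].
Qed.

Lemma no_uniform_index a j : S a -> IsLimit lt a -> rk (C a) a ≺ lam -> j ≺ lam ->
  ~ forall b, b ≺ a -> exists x, x ≺ a /\ good b x /\ idx a x ≼ j.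
Proof.
  intros HSa Ha Hrk Hj H.
  set (th := inL Hrk : L). set (j' := inL Hj : L).
  destruct (choice (fun i y => guess_dom th j' (counter th j') i a y /\
    ~ counter th j' i (c y (th, j', i)))) as [Y HY].
  { intros i. destruct (counter_spec th j' i) as [_ Hi].
    apply Hi; [exact HSa|exact Ha|reflexivity|].
    (* A good point guesses every counterexample correctly, so it belongs to the domain of each
       stage and supplies values cofinal in [a]. *)
    intros b Hb. destruct (H b Hb) as (x & Hx & Hgood & Hidx).
    exists x. split; [|apply Hgood]. split; [exact Hx|]. split; [exact Hidx|].
    split; [apply Hgood|]. intros i' _. apply Hgood. }
  apply (idx_small a j Y Ha Hrk Hj).
  - intros i. destruct (HY i) as [(H1 & H2 & _) _]. auto.
  (* For [i] before [i'], the point [Y i'] guesses the [i]-th counterexample correctly while [Y i]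
     does not. *)
  - assert (Hne : forall i i', proj1_sig i ≺ proj1_sig i' -> Y i <> Y i').
    { intros i i' Hi E. destruct (HY i) as [_ H1]. destruct (HY i') as [(_ & _ & _ & H2) _].
      apply H1. rewrite E. apply H2, Hi. }
    intros i i' E. apply below_ext.
    destruct (ltK_total (proj1_sig i) (proj1_sig i')) as [h|[h|h]]; [|exact h|];
      apply Hne in h; congruence.
Qed.

Definition level (a b : K) : K :=
  least (fun j => exists x, x ≺ a /\ good b x /\ idx a x ≼ j).

Lemma level_spec a b : good_points a -> b ≺ a ->
  level a b ≺ lam /\ exists x, x ≺ a /\ good b x /\ idx a x ≼ level a b.
Proof.
  intros [Ha HE] Hb. destruct (HE b Hb) as (x & Hx & Hgood).
  destruct (least_spec (fun j => exists x, x ≺ a /\ good b x /\ idx a x ≼ j)) as [H1 H2].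
  { exists (idx a x), x. auto using leK_refl. }
  split; [|exact H1]. fold (level a b) in H2.
  assert (level a b ≼ idx a x) by (apply H2; exists x; auto using leK_refl).
  pose proof (idx_lt a x Ha Hx). order.
Qed.

Lemma level_mono a b b' : good_points a -> b ≼ b' -> b' ≺ a -> level a b ≼ level a b'.
Proof.
  intros HE Hb Hb'. destruct (level_spec a b' HE Hb') as (_ & x & Hx & Hgood & Hidx).
  apply (least_spec (fun j => exists x, x ≺ a /\ good b x /\ idx a x ≼ j)).
  - exists (level a b'), x. eauto using good_mono.
  - exists x. eauto using good_mono.
Qed.

Lemma otp_le_lam a x : IsLimit lt a -> rk (C a) x ≼ lam.
Proof. intros Ha. apply OtpLe_rk. apply (HC a Ha). Qed.

(** The order type below a point is a monotone map from [a] onto [lam], up to cofinality. *)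
Lemma otp_lam_cf a : IsLimit lt a -> rk (C a) a = lam ->
  forall g, IsCf lt a g <-> IsCf lt lam g.
Proof.
  intros Ha E. apply (cf_transfer a lam (rk (C a))).
  - apply lam_limit.
  - intros x Hx. destruct (C_unbounded a x Ha Hx) as (y & Hy & Hxy).
    pose proof (rk_le (C a) x y (ltK_leK _ _ Hxy)).
    pose proof (rk_lt (C a) a y Hy (C_lt a y Ha Hy)). order.
  - intros x y Hxy _. apply rk_le, Hxy.
  - intros z Hz. rewrite <- E in Hz. apply rk_onto in Hz.
    destruct Hz as (y & _ & Hy & <-). exists y. split; [exact Hy|apply leK_refl].
Qed.

(** At a good point of [S], either [level a] is bounded below [lam], giving a uniform index bound,
    or it is a monotone cofinal map into [lam], which would equate the two cofinalities. Order type
    [lam] is excluded for the same reason. *)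
Lemma stationary_cf_neq_absurd : Stationary lt S -> ~ forall a, S a -> CfNeq lt a lam.
Proof.
  intros Hstat Hcf. destruct (Hstat _ good_points_club) as (a & HSa & HE).
  pose proof (proj1 HE) as Ha.
  assert (Habs : ~ forall g, IsCf lt a g <-> IsCf lt lam g).
  { intros H. destruct (cf_exists a) as [g Hg]. apply (Hcf a HSa g Hg), H, Hg. }
  destruct (classic (exists j, j ≺ lam /\ forall b, b ≺ a -> level a b ≼ j)) as [(j & Hj & H)|N].
  - apply (no_uniform_index a j HSa Ha); [|exact Hj|].
    + destruct (otp_le_lam a a Ha) as [h|h]; [exact h|].
      exfalso. apply Habs, otp_lam_cf; assumption.
    + intros b Hb. destruct (level_spec a b HE Hb) as (_ & x & Hx & Hgood & Hidx).
      exists x. split; [exact Hx|]. split; [exact Hgood|]. specialize (H b Hb). order.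
  - apply Habs. apply (cf_transfer a lam (level a)).
    + apply lam_limit.
    + intros x Hx. apply level_spec; assumption.
    + intros x y Hxy Hy. apply level_mono; assumption.
    + intros z Hz. apply NNPP. intros h. apply N. exists z. split; [exact Hz|].
      intros b Hb. apply NNPP. intros h'. apply h. exists b. split; [exact Hb|order].
Qed.

(* Unlike in the previous case [level a] may be unbounded here, but below a point [b] it is bounded
   by [level a b]. *)
Lemma reflecting_absurd : ~ ReflectsStatOften lt S.
Proof.
  intros Hrefl. destruct (Hrefl _ good_points_club) as (a & [Hcf Hstat] & HE).
  pose proof (proj1 HE) as Ha.
  destruct (Hstat (fun b => Acc lt (C a) b /\
    forall y, y ≺ b -> exists x, x ≺ b /\ good y x /\ idx a x ≼ level a b))
    as (b & Hb & HSb & Hacc & H).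
  { split; [|split].
    - intros b [Hb _]. apply (Acc_C a b Ha Hb).
    - intros b Hb.
      (* Between consecutive terms lies a point of [C a], and below the next term a good witness of
         least possible index bound, so the supremum of the chain has both required properties. *)
      destruct (omega_chain (fun y => y ≺ a) (fun y z => (exists d, C a d /\ y ≺ d /\ d ≺ z) /\
        exists x, x ≺ z /\ good y x /\ idx a x ≼ level a y)) with (b := b)
        as (s & Hs0 & Hs); [|exact Hb|].
      { intros y Hy. destruct (level_spec a y HE Hy) as (_ & x & Hx & Hgood & Hidx).
        destruct (C_unbounded a y Ha Hy) as (d & Hd & Hyd).
        pose proof (C_lt a d Ha Hd) as Hda.
        assert (Hm : maxK d x ≺ a).
        { unfold maxK. destruct (excluded_middle_informative (d ≺ x)); assumption. }
        destruct (proj2 Ha _ Hm) as (z & Hz & Hza).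
        assert (Hle : d ≼ maxK d x /\ x ≼ maxK d x) by apply maxK_spec, leK_refl.
        destruct Hle. exists z. split; [exact Hza|]. split; [order|]. split.
        - exists d. split; [exact Hd|]. split; order.
        - exists x. split; [order|auto]. }
      (* Uncountable cofinality keeps the supremum of the chain below [a]. *)
      destruct (CfGtOmega_bounded a s Hcf) as (z & Hza & Hz); [apply Hs|].
      destruct (limit_sup nat 0 s z) as (e & Hez & He & He1 & He2); [|exact Hz|].
      { intros n. exists (Datatypes.S n). apply Hs. }
      assert (Hea : e ≺ a) by order.
      exists e. split; [|split; [exact Hea|rewrite <- Hs0; apply He1]].
      split.
      + apply Acc_C_intro; [exact Ha|exact Hea|apply He|].
        intros x Hx. destruct (He2 x Hx) as [n Hn].
        destruct (Hs n) as (_ & _ & (d & Hd & Hnd & Hdn) & _). exists d.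
        specialize (He1 (Datatypes.S n)). split; [exact Hd|]. split; order.
      + intros y Hy. destruct (He2 y Hy) as [n Hn].
        destruct (Hs n) as (_ & _ & _ & x & Hx & Hgood & Hidx). exists x.
        pose proof (He1 (Datatypes.S n)). split; [order|].
        split; [apply (good_mono y (s n)); [order|exact Hgood]|].
        pose proof (level_mono a (s n) e HE (ltK_leK _ _ (He1 n)) Hea). order.
    - intros e He Hne H. split.
      + apply Acc_C_intro; [exact Ha|exact He|exact Hne|].
        intros x Hx. destruct (H x Hx) as (d & [[_ Hd] _] & Hxd). eauto.
      + intros y Hy. destruct (H y Hy) as (d & [_ Hd] & Hyd & Hde).
        destruct (Hd y Hyd) as (x & Hx & Hgood & Hidx). exists x. split; [order|].
        split; [exact Hgood|].
        pose proof (level_mono a d e HE (ltK_leK _ _ Hde) He). order. }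
  destruct (Acc_C a b Ha Hacc) as (_ & HLb & _ & _ & Hrk).
  apply (no_uniform_index b (level a b) HSb HLb).
  (* As an accumulation point of [C a], [b] has order type strictly below that of [a], hence below
     [lam]. *)
  - pose proof (otp_le_lam a a Ha). order.
  - apply level_spec; assumption.
  - intros y Hy. destruct (H y Hy) as (x & Hx & Hgood & Hidx). exists x.
    split; [exact Hx|]. split; [exact Hgood|].
    unfold idx in *. rewrite (next_coherent a b x Ha Hacc Hx). exact Hidx.
Qed.

End Main.

(** * Assembling the equivalences *)

Lemma club_square_of_square : CH lt lam -> forall S : K -> Prop,
  (Stationary lt S /\ (forall a, S a -> CfNeq lt a lam)) \/ ReflectsStatOften lt S ->
  ClubSquare lt lam S.
Proof.
  intros HCH S HS. apply NNPP. intros N.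
  destruct index_exists as [ind Hind].
  destruct (codes (L * L * L) HCH) as [c Hc].
  { apply embeds_trans with (2 := lam_square).
    apply embeds_prod; [exact lam_square|apply embeds_refl]. }
  destruct HS as [[H1 H2]|H].
  - exact (stationary_cf_neq_absurd ind Hind c Hc S N H1 H2).
  - exact (reflecting_absurd ind Hind c Hc S N H).
Qed.

End Square.

Lemma square_of_club_square S : ClubSquare lt lam S -> Square lt lam.
Proof. intros (C & _ & H & _). exists C. exact H. Qed.

Lemma all_reflects : ReflectsStatOften lt (fun _ => True).
Proof.
  intros D HD. destruct (CfGtOmega_stationary D HD) as (a & Ha & HDa).
  exists a. split; [|exact HDa]. split; [exact Ha|].
  intros E (HE1 & HE2 & _). destruct Ha as (g & [[f _] _] & Hg).
  destruct (f (exist _ omega (Hg _ omega_IsOmega))) as [b Hb].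
  (* Stationarity of the whole space in [a] only asks that clubs in [a] be nonempty; the point [b]
     below [a] comes from the cofinal map. *)
  destruct (HE2 b Hb) as (c & Hc & _). exists c. auto.
Qed.

End Development.

Theorem theoremA (K : Type) (lt : K -> K -> Prop) (lam : K) :
  StrictWellOrder lt -> SuccCardModel lt lam -> CH lt lam ->
  (Square lt lam <->
     (forall S : K -> Prop, Stationary lt S ->
        (forall a, S a -> CfNeq lt a lam) -> ClubSquare lt lam S)) /\
  (Square lt lam <->
     (forall S : K -> Prop, ReflectsStatOften lt S -> ClubSquare lt lam S)).
Proof.
  intros WO SC HCH. split; split.
  - intros [C HC] S HS Hcf. apply (club_square_of_square lt WO lam SC C HC HCH). auto.
  (* To recover the square sequence it suffices to have one stationary set of the allowed kind, here
     the largest one. *)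
  - intros H. apply (square_of_club_square lt lam (fun a => CfNeq lt a lam)), H; [|auto].
    exact (CfNeq_stationary lt WO lam SC).
  - intros [C HC] S HS. apply (club_square_of_square lt WO lam SC C HC HCH). auto.
  - intros H. apply (square_of_club_square lt lam (fun _ => True)), H.
    exact (all_reflects lt WO lam SC).
Qed.
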